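(* For any $n+1$ points in the plane in convex position, the mixing time of the flip chain over their non-crossing spanning trees satisfies $t_{\mathrm{mix}}(P_{\mathrm{FM}}) = O(n^8\log n)$, where the asymptotics are as $n\to\infty$ and the implied constant is absolute.
   Context: Given $n+1$ points in convex position (they are the vertices of a convex polygon), a non-crossing spanning tree (NCST) is a spanning tree on these points such that, when all edges are drawn as straight line segments, no two edges intersect except possibly at a common endpoint. Every NCST has $n$ edges. The flip chain $P_{\mathrm{FM}}$ is the Markov chain whose state space is the set of all NCSTs of the given points. In each step, from the current tree $S$, an edge of $S$ is chosen uniformly at random and removed; then an edge is added, chosen uniformly at random among all edges (including the removed one) whose addition results in an NCST. Thus for $S\ne T$, $P_{\mathrm{FM}}(S,T)=\frac{1}{n\,\delta(S,T)}$ if $|S\cap T|=n-1$ (trees viewed as edge sets), where $\delta(S,T)$ is the number of edges that can be added to $S\cap T$ to make it an NCST, and $P_{\mathrm{FM}}(S,T)=0$ if $|S\cap T|<n-1$; the remaining probability is placed on $P_{\mathrm{FM}}(S,S)$. Its stationary distribution $\pi$ is uniform over all NCSTs. For a Markov chain $P$ on a finite state space $\Omega$ with stationary distribution $\pi$, let $d(t)=\max_{x\in\Omega} d_{\mathrm{TV}}(P^t(x,\cdot),\pi)$, where $d_{\mathrm{TV}}(\mu,\nu)=\frac12\sum_{x\in\Omega}|\mu(x)-\nu(x)|$. The mixing time is $t_{\mathrm{mix}}(P)=\min\{t: d(t)\le 1/4\}$. *)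

(* Defs.v *)
From HB Require Import structures.
From mathcomp Require Import all_boot all_order all_algebra.
From mathcomp Require Import all_classical all_reals all_analysis.

Set Implicit Arguments.
Unset Strict Implicit.
Unset Printing Implicit Defensive.

Import Order.TTheory GRing.Theory Num.Theory.
Local Open Scope ring_scope.

Section MixingTime.
Variables (R : realType) (Omega : finType).
Implicit Types (mu nu pi : Omega -> R) (P : Omega -> Omega -> R).

Definition stochastic P : Prop :=
  (forall x y, 0 <= P x y) /\ (forall x, \sum_y P x y = 1).

Definition stationary P pi : Prop :=
  [/\ forall x, 0 <= pi x, \sum_x pi x = 1
    & forall y, \sum_x pi x * P x y = pi y].

Fixpoint kernel_pow P (t : nat) (x y : Omega) : R :=
  if t is t'.+1 then \sum_z P x z * kernel_pow P t' z y else (x == y)%:R.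

Definition dTV mu nu : R := 2^-1 * \sum_x `|mu x - nu x|.

Definition mix_dist P pi (t : nat) : R :=
  \big[Num.max/0]_x dTV (kernel_pow P t x) pi.

(* Extended-real valued: +oo if d(t) <= 1/4 never happens; otherwise the
   infimum is a minimum, being taken over a nonempty set of naturals. *)
Definition t_mix P pi : \bar R :=
  ereal_inf [set (t%:R)%:E | t in [set t : nat | mix_dist P pi t <= 4^-1]]%classic.

Definition uniform_dist : Omega -> R := fun=> #|Omega|%:R^-1.

End MixingTime.

Section Trees.
Variable V : finType.
Implicit Type T : {set {set V}}.

Definition adj T : rel V := fun u v => [set u; v] \in T.

Definition spanning_tree T : Prop :=
  [/\ forall e, e \in T -> #|e| = 2%N,
      forall u v, connect (adj T) u v
    & forall c : seq V, (2 < size c)%N -> ~ ucycle (adj T) c].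

End Trees.

Section Geometry.
Variables (R : realType) (n : nat) (p : 'I_n.+1 -> 'rV[R]_2).
Implicit Types (e f : {set 'I_n.+1}) (S T F : {set {set 'I_n.+1}}).

Definition hull (A : {set 'I_n.+1}) : set 'rV[R]_2 :=
  [set x | exists w : 'I_n.+1 -> R,
     [/\ forall i, 0 <= w i, \sum_(i in A) w i = 1
       & x = \sum_(i in A) w i *: p i]]%classic.

Definition convex_position : Prop := forall i, ~ hull [set~ i] (p i).

(* For an edge e = {i, j}, hull e is the straight segment from p i to p j. *)
Definition non_crossing T : Prop :=
  forall e f, e \in T -> f \in T -> e != f ->
  forall x, hull e x -> hull f x -> exists2 i, i \in e :&: f & x = p i.

Definition ncst T : Prop := spanning_tree T /\ non_crossing T.

Definition NCST : finType := {T : {set {set 'I_n.+1}} | `[< ncst T >]}.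

(* Vertex labels stand for points and 2-element sets of labels for edges. The
   edges that complete F to a non-crossing spanning tree; for F = S :\ e with
   e \in S this contains e itself. *)
Definition addable F : {set {set 'I_n.+1}} :=
  [set f | (f \notin F) && `[< ncst (f |: F) >]].

(* Remove a uniform e \in S (S has n edges), then add a uniform element f of
   addable (S :\ e); flip_chain_neq below gives the closed form off the
   diagonal. *)
Definition flip_chain (S T : NCST) : R :=
  \sum_(e in val S) #|val S|%:R^-1 *
    \sum_(f in addable (val S :\ e))
      #|addable (val S :\ e)|%:R^-1 * (val T == f |: (val S :\ e))%:R.

Definition flip_t_mix : \bar R := t_mix flip_chain (@uniform_dist R NCST).

Lemma flip_chain_ge0 (S T : NCST) : 0 <= flip_chain S T.
Proof.
rewrite /flip_chain; apply: sumr_ge0 => e _.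
apply: mulr_ge0; rewrite ?invr_ge0 //.
by apply: sumr_ge0 => f _; rewrite mulr_ge0 ?invr_ge0.
Qed.

Lemma mem_addable (S : NCST) e : e \in val S -> e \in addable (val S :\ e).
Proof.
move=> eS; rewrite inE finset.setD11 /= finset.setD1K //; exact: (valP S).
Qed.

Lemma NCST_neq0 (S : NCST) : (0 < n)%N -> (0 < #|val S|)%N.
Proof.
move=> n0; have /asboolP[[_ cS _] _] := valP S.
have /connectP[[|u q] /= + eq] := cS ord0 ord_max.
  by move=> _; have /(congr1 val)/= n_eq := eq; suff: (0 < 0)%N by []; rewrite -[X in (_ < X)%N]n_eq.
by move=> /andP[+ _]; rewrite /adj => uS; apply/card_gt0P; exists [set ord0; u].
Qed.

Lemma flip_chain_stochastic : (0 < n)%N -> stochastic flip_chain.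
Proof.
move=> n0; split; first exact: flip_chain_ge0.
move=> S; rewrite /flip_chain exchange_big /=.
transitivity (\sum_(e in val S) (#|val S|%:R^-1 : R)).
  apply: eq_bigr => e eS; rewrite -mulr_sumr exchange_big /=.
  rewrite (eq_bigr (fun=> #|addable (val S :\ e)|%:R^-1)).
    rewrite sumr_const -[X in _ * X]mulr_natl divff ?mulr1 // pnatr_eq0 -lt0n.
    by apply/card_gt0P; exists e; apply: mem_addable.
  move=> f; rewrite inE => /andP[_ fS]; rewrite -mulr_sumr.
  pose T0 : NCST := Sub (f |: (val S :\ e)) fS.
  rewrite (bigD1 T0) //= eqxx big1 ?addr0 ?mulr1 // => T.
  by rewrite -val_eqE /= => /negbTE ->.
by rewrite sumr_const -[LHS]mulr_natl divff // pnatr_eq0 -lt0n NCST_neq0.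
Qed.

Lemma flip_move S T e f : e \in S -> f \notin S :\ e -> S != T ->
  T = f |: (S :\ e) ->
  [/\ S :\ e = S :&: T, S :\: T = [set e] & T :\: S = [set f]].
Proof.
move=> eS fSe neST defT.
have fe : f != e by apply: contraNneq neST => fe; rewrite defT fe finset.setD1K.
have fS : f \notin S by move: fSe; rewrite !inE fe.
split; apply/setP => x; rewrite defT !inE.
- by case: (eqVneq x f) => [->|_]; rewrite ?(negbTE fS) ?andbF // andbC;
    case: (x \in S).
- case: (eqVneq x e) => [->|_] /=; last by case: (x \in S); rewrite ?orbT ?andbF.
  by rewrite eS eq_sym (negbTE fe).
- case: (eqVneq x f) => [->|_] /=; first by rewrite fS.
  by case: (x \in S); rewrite ?andbF.
Qed.

(* Here #|val S| = n and #|addable (val S :&: val T)| = delta(S, T). *)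
Lemma flip_chain_neq (S T : NCST) : S != T ->
  flip_chain S T =
    if (#|val S :&: val T|.+1 == #|val S|) && (#|val S :&: val T|.+1 == #|val T|)
    then (#|val S|%:R * #|addable (val S :&: val T)|%:R)^-1 else 0.
Proof.
rewrite -val_eqE => neST; rewrite /flip_chain.
case: ifPn => [/andP[/eqP cS /eqP cT]|nc].
- have /eqP/cards1P[e De] : #|val S :\: val T| = 1%N.
    by apply/eqP; rewrite -(eqn_add2l #|val S :&: val T|) cardsID -cS addn1.
  have /eqP/cards1P[f Df] : #|val T :\: val S| = 1%N.
    by apply/eqP; rewrite -(eqn_add2l #|val T :&: val S|) cardsID finset.setIC -cT addn1.
  have : e \in val S :\: val T by rewrite De set11.
  rewrite inE => /andP[eT eS].
  have : f \in val T :\: val S by rewrite Df set11.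
  rewrite inE => /andP[fS fT].
  have Ie : val S :\ e = val S :&: val T.
    by rewrite -De finset.setDDr finset.setDv finset.set0U.
  have defT : val T = f |: (val S :\ e).
    by rewrite Ie -Df finset.setUC finset.setIC finset.setID.
  have fa : f \in addable (val S :\ e).
    rewrite inE -defT; apply/andP; split; last exact: (valP T).
    by rewrite !inE (negbTE fS) andbF.
  rewrite (bigD1 e) //= [X in _ + X]big1 ?addr0; last first.
    move=> e' /andP[e'S ne]; rewrite big1 ?mulr0 // => f'.
    rewrite inE => /andP[f'N _]; case: eqP => [eqT|]; rewrite ?mulr0 //.
    have [_ De' _] := flip_move e'S f'N neST eqT.
    by have := set11 e'; rewrite -De' De inE (negbTE ne).
  rewrite (bigD1 f) //= [X in _ + X]big1 ?addr0; last first.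
    move=> f' /andP[+ ne]; rewrite inE => /andP[f'N _].
    case: eqP => [eqT|]; rewrite ?mulr0 //.
    have [_ _ Df'] := flip_move eS f'N neST eqT.
    by have := set11 f'; rewrite -Df' Df inE (negbTE ne).
  by rewrite -defT eqxx mulr1 Ie invfM.
- rewrite big1 // => e eS; rewrite big1 ?mulr0 // => f.
  rewrite inE => /andP[fN _]; case: eqP => [eqT|]; rewrite ?mulr0 //.
  have [Ie De Df] := flip_move eS fN neST eqT.
  case/negP: nc; apply/andP; split; apply/eqP.
    by rewrite -[RHS](cardsID (val T)) De cards1 addn1.
  by rewrite -[RHS](cardsID (val S)) Df cards1 addn1 finset.setIC.
Qed.

Lemma flip_chain_sym (S T : NCST) : flip_chain S T = flip_chain T S.
Proof.
have [->//|neST] := eqVneq S T.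
have neTS : T != S by rewrite eq_sym.
rewrite (flip_chain_neq neST) (flip_chain_neq neTS) (finset.setIC (val T)) andbC.
by case: ifP => // /andP[/eqP <- /eqP <-].
Qed.

Lemma flip_chain_stationary : (0 < n)%N -> (0 < #|NCST|)%N ->
  stationary flip_chain (@uniform_dist R NCST).
Proof.
move=> n0 N0; have [_ row1] := flip_chain_stochastic n0.
split=> [S||T]; first by rewrite invr_ge0.
- by rewrite /uniform_dist sumr_const -[LHS]mulr_natl divff // pnatr_eq0 -lt0n.
- rewrite -mulr_sumr (eq_bigr (flip_chain T)) ?row1 ?mulr1 // => S _.
  exact: flip_chain_sym.
Qed.

End Geometry.

(* Main.v *)
Require Import Defs.
From HB Require Import structures.
From mathcomp Require Import all_boot all_order all_algebra.
From mathcomp Require Import all_classical all_reals all_analysis.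
From mathcomp Require Import zify ring lra.

Set Implicit Arguments.
Unset Strict Implicit.
Unset Printing Implicit Defensive.

Import Order.TTheory GRing.Theory Num.Theory.
Local Open Scope ring_scope.

(** Non-crossing spanning trees of n + 1 points in convex position are in
    bijection with ternary trees with n nodes, hence with certain words in two
    letters.  The proof bounds the relaxation time of the flip chain by O(n^7)
    through this coding.

    The words first.  Read in preorder, a ternary tree is a lattice path with
    steps +2 (a node) and -1 (an empty tree) that stays nonnegative.  A function
    on uniform words of length m has variance at most m^2 times its mean squared
    variation under transpositions of adjacent letters ([fvar_le]).  The
    letters are revealed one at a time; the two conditional means that arise
    from revealing a letter differ by a transposition plus a sub-convex
    combination of two differences of the same kind for shorter words
    ([swap_gap]), because the number of completions is log-concave in the height
    ([count_forests_logconcave]).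

    Next the trees.  Transposing two adjacent letters amounts to at most n
    rotations, which re-bracket three nested triples; the paths used by distinct
    transpositions share no rotation, so only a factor O(n) is lost
    ([graft_cost_le], [inner_swaps_le]).  A tree admits at most 3 n of the
    rotations in question ([rotation_sum_le]).  Together this is the Poincare
    inequality [trees_poincare].

    Then the geometry.  A ternary tree is the dual of a quadrangulation of a
    (2 n + 2)-gon whose vertices are alternately the n + 1 points and the n + 1
    gaps between them; each quadrilateral has one diagonal that joins two points,
    and these diagonals form the non-crossing spanning tree ([edges]).  A rotation
    re-cuts a hexagon; its three points span a triangle of which the tree uses two
    sides, and the rotation changes which two ([edges_rotation]).  So a
    rotation is a flip, and the flip chain makes it with probability at least
    1 / (n (n + 1)^2) ([flip_chain_ge]).  That every non-crossing spanning tree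
    arises exactly once is [edges_inj] and [edges_decode]; that crossing of
    segments is interleaving of their ends in one cyclic order is
    [cyclic_order] and [non_crossingP].

    Finally the mixing time.  A step deletes an edge and then averages over the
    completions, so the kernel is an averaging operator times its adjoint and is
    positive semidefinite ([sqr_step_le]); with the Poincare inequality each
    step contracts the variance by 1 - 1/K with K = O(n^7) ([poincare]).  There
    are at most 2^(3 n) trees, so O(n) half-lives of K steps are enough
    ([t_mix_le]), which is O(n^8) steps and a fortiori O(n^8 log n). *)

(** * Ternary trees, forests and their codings by words *)
Inductive tree := Leaf | Node of tree & tree & tree.

HB.instance Definition _ := gen_eqMixin tree.

Fixpoint nodes t : nat :=
  if t is Node a b c then (nodes a + nodes b + nodes c).+1 else 0%N.

(** The forests coded by words: reading a word from its last letter, one letter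
    puts an empty tree in front of the forest and the other, [grow], joins the
    first three trees under a new root. *)
Definition grow (F : seq tree) : seq tree :=
  if F is [:: a, b, c & F'] then Node a b c :: F' else F.

(** The forests of h + 1 trees whose words have m letters.  Listing them by first
    letter makes every sum over forests unfold one letter at a time. *)
Fixpoint forests (m h : nat) : seq (seq tree) :=
  if m is m'.+1 then
    map grow (forests m' h.+2) ++
    (if h is h'.+1 then map (cons Leaf) (forests m' h') else [::])
  else if h is 0%N then [:: [:: Leaf]] else [::].

Lemma size_forests m h F : F \in forests m h -> size F = h.+1.
Proof.
elim: m h F => [|m IH] [|h] F //=; first by rewrite inE => /eqP ->.
  by rewrite cats0 => /mapP[G /IH + ->]; case: G => [|a [|b [|c G]]] //= [->].
rewrite mem_cat => /orP[] /mapP[G /IH + ->]; last by move=> /= ->.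
by case: G => [|a [|b [|c G]]] //= [->].
Qed.

Lemma mem_forests m h F :
  (F \in forests m h) =
  (size F == h.+1) && (3 * sumn (map nodes F) + h == m)%N.
Proof.
apply/idP/andP => [|[/eqP + /eqP]].
  elim: m h F => [|m IH] [|h] F //=; first by rewrite inE => /eqP ->.
    rewrite cats0 => /mapP[G /IH[+ +] ->].
    by case: G => [|a [|b [|c [|d G]]]] //= _ /eqP <-; split=> //; apply/eqP; lia.
  rewrite mem_cat => /orP[] /mapP[G /IH[+ +] ->] /=.
    case: G => [|a [|b [|c G]]] //= /eqP[->] /eqP <-.
    by split=> //; apply/eqP; lia.
  by move=> /eqP -> /eqP <-; split=> //; apply/eqP; lia.
elim: m h F => [|m IH] h F sF sz.
  case: h sF sz => [|h] sF sz; last lia.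
  by case: F sF sz => [|[|a b c] [|]] //= _; rewrite ?mem_seq1 //; lia.
case: F sF sz => [|[|a b c] F] //= [sF] sz.
  case: h sF sz => [|h] sF sz.
    by move: sz; rewrite (size0nil sF) /=; lia.
  rewrite mem_cat; apply/orP; right; apply/map_f/IH => //; lia.
rewrite mem_cat; apply/orP; left.
apply/mapP; exists [:: a, b, c & F] => //; apply: IH => /=; lia.
Qed.

Lemma uniq_forests m h : uniq (forests m h).
Proof.
elim: m h => [|m IH] [|h] //=; rewrite ?cats0 ?cat_uniq.
  rewrite map_inj_in_uniq // => F G /size_forests + /size_forests.
  by move: F G => [|a [|b [|c F]]] // [|a' [|b' [|c' G]]] //= _ _ [-> -> -> ->].
rewrite !map_inj_in_uniq ?IH /=; last 2 first.
- by move=> F G _ _ [].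
- move=> F G /size_forests + /size_forests.
  by move: F G => [|a [|b [|c F]]] // [|a' [|b' [|c' G]]] //= _ _ [-> -> -> ->].
rewrite andbT; apply/hasPn => _ /mapP[F _ ->]; apply/mapP => -[G /size_forests].
by move: G => [|a [|b [|c G]]].
Qed.

Definition count_forests m h : nat := size (forests m h).

Lemma count_forests0 m : count_forests m.+1 0 = count_forests m 2.
Proof. by rewrite /count_forests /= cats0 size_map. Qed.

Lemma count_forestsS m h :
  count_forests m.+1 h.+1 = (count_forests m h.+3 + count_forests m h)%N.
Proof. by rewrite /count_forests /= size_cat !size_map. Qed.

Lemma count_forests_le m h : (count_forests m h <= 2 ^ m)%N.
Proof.
elim: m h => [|m IH] [|h] //; first by rewrite count_forests0 (leq_trans (IH _)) // leq_exp2l.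
by rewrite count_forestsS expnS mul2n -addnn leq_add.
Qed.

(** In steps of 3, the counts for m + 1 are sums of two consecutive counts for m,
    cut off at height 0; both operations preserve log-concavity.  The induction
    moves the two indices apart, hence the parameter [k]. *)
Lemma count_forests_logconcave m i k :
  (count_forests m i * count_forests m (i + 3 * k + 6) <=
   count_forests m (i + 3) * count_forests m (i + 3 * k + 3))%N.
Proof.
elim: m i k => [|m IH] i k.
  by rewrite {2}/count_forests /= addnS muln0.
set c := count_forests.
case: i => [|i].
  rewrite !add0n /c count_forests0.
  have -> : (3 * k + 6 = (3 * k + 5).+1)%N by lia.
  have -> : (3 * k + 3 = (3 * k + 2).+1)%N by lia.
  rewrite !count_forestsS -!/c.
  have := IH 2%N k; rewrite -/c.
  have -> : (2 + 3 * k + 6 = (3 * k + 5).+3)%N by lia.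
  have -> : (2 + 3 * k + 3 = (3 * k + 2).+3)%N by lia.
  have -> : (3 * k + 5 = (3 * k + 2).+3)%N by lia.
  by rewrite (_ : (2 + 3 = 5)%N) //; nia.
have -> : (i.+1 + 3 * k + 6 = (i + 3 * k + 6).+1)%N by lia.
have -> : (i.+1 + 3 * k + 3 = (i + 3 * k + 3).+1)%N by lia.
rewrite addSn /c !count_forestsS -/c.
have H1 := IH (i + 3)%N k; have H2 := IH i k; have H3 := IH i k.+1.
have H4 : (c m i * c m (i + 3 * k + 9) <= c m (i + 6) * c m (i + 3 * k + 3))%N.
  have E9 : (i + 3 * k.+1 + 6 = i + 3 * k + 9)%N by lia.
  have E6 : (i + 3 * k.+1 + 3 = i + 3 * k + 6)%N by lia.
  move: H3; rewrite E9 E6 -/c => H3; apply: (leq_trans H3).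
  case: (k) => [|k']; first by rewrite muln0 addn0 mulnC.
  have := IH (i + 3)%N k'.
  have -> : (i + 3 + 3 * k' + 6 = i + 3 * k'.+1 + 6)%N by lia.
  have -> : (i + 3 + 3 * k' + 3 = i + 3 * k'.+1 + 3)%N by lia.
  by have -> : (i + 3 + 3 = i + 6)%N by lia.
move: H1 H2 H4; rewrite -!/c.
have -> : (i + 3 + 3 * k + 6 = i + 3 * k + 9)%N by lia.
have -> : (i + 3 + 3 * k + 3 = i + 3 * k + 6)%N by lia.
have -> : (i + 3 + 3 = i + 6)%N by lia.
have -> : ((i + 3 * k + 6).+3 = i + 3 * k + 9)%N by lia.
have -> : ((i + 3 * k + 3).+3 = i + 3 * k + 6)%N by lia.
have -> : ((i + 3).+3 = i + 6)%N by lia.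
have -> : (i.+3 = i + 3)%N by lia.
nia.
Qed.

(** Ternary re-bracketings of five subtrees, in one direction and at any node. *)
Inductive rotation : tree -> tree -> Prop :=
| Rot12 a x y z c : rotation (Node a (Node x y z) c) (Node (Node a x y) z c)
| Rot23 a b x y z : rotation (Node a b (Node x y z)) (Node a (Node b x y) z)
| Rot13 a b x y z : rotation (Node a b (Node x y z)) (Node (Node a b x) y z)
| Rot1 a a' b c : rotation a a' -> rotation (Node a b c) (Node a' b c)
| Rot2 a b b' c : rotation b b' -> rotation (Node a b c) (Node a b' c)
| Rot3 a b c c' : rotation c c' -> rotation (Node a b c) (Node a b c').

Fixpoint spine t : nat := if t is Node _ _ c then (spine c).+1 else 0%N.

Definition trees n : seq tree := [seq head Leaf F | F <- forests (3 * n) 0].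

(** Following third children to the end: the empty tree that a word closes last. *)
Fixpoint graft (a v : tree) : tree :=
  if a is Node x y z then Node x y (graft z v) else v.

(** * A Poincare inequality for transpositions of letters *)
Section Poincare.
Variable R : realFieldType.
Implicit Types (f g : seq tree -> R) (G : tree -> R).

Definition fsum m h f : R := \sum_(F <- forests m h) f F.

Lemma eq_fsum m h f g :
  (forall F, size F = h.+1 -> f F = g F) -> fsum m h f = fsum m h g.
Proof. by move=> e; apply: eq_big_seq => F /size_forests; apply: e. Qed.

Lemma ler_fsum m h f g :
  (forall F, size F = h.+1 -> f F <= g F) -> fsum m h f <= fsum m h g.
Proof.
by move=> e; rewrite /fsum [leLHS]big_seq [leRHS]big_seq;
  apply: ler_sum => F /size_forests; apply: e.
Qed.

Lemma fsum_empty m h f : count_forests m h = 0%N -> fsum m h f = 0.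
Proof. by move=> /size0nil e; rewrite /fsum e big_nil. Qed.

Lemma fsum_ge0 m h f : (forall F, 0 <= f F) -> 0 <= fsum m h f.
Proof. by move=> f0; apply: sumr_ge0. Qed.

Lemma fsumD m h f g :
  fsum m h (fun F => f F + g F) = fsum m h f + fsum m h g.
Proof. exact: big_split. Qed.

Lemma fsumZ m h k f : fsum m h (fun F => k * f F) = k * fsum m h f.
Proof. by rewrite /fsum mulr_sumr. Qed.

Lemma fsum0S m f : fsum 0 m.+1 f = 0.
Proof. exact: big_nil. Qed.

Lemma fsumS0 m f : fsum m.+1 0 f = fsum m 2 (f \o grow).
Proof. by rewrite /fsum /= cats0 big_map. Qed.

Lemma fsumSS m h f :
  fsum m.+1 h.+1 f = fsum m h.+3 (f \o grow) + fsum m h (f \o cons Leaf).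
Proof. by rewrite /fsum /= big_cat !big_map. Qed.

(** The letters transposed are the one that closes the last empty tree of [a]
    and the one that opens the next tree of the forest: the node moves to the end
    of [a], and its third child takes its place. *)
Definition swap_cost f F : R :=
  if F is [:: a, Node x y z & F'] then
    (f F - f [:: graft a (Node Leaf x y), z & F']) ^+ 2
  else 0.

Arguments swap_cost : simpl never.

Lemma swap_cost_ge0 f F : 0 <= swap_cost f F.
Proof. by rewrite /swap_cost; case: F => [|a [|[|x y z] F]] //; rewrite sqr_ge0. Qed.

Definition on_children G F : R := G (head Leaf (grow F)).

(** The transpositions inside one tree; those between siblings are swaps in the
    forest of the children of a node. *)
Fixpoint inner_swaps G t : R :=
  if t is Node a b c then
    let f := on_children G in
    swap_cost f [:: a; b; c] + swap_cost (fun F => f (a :: F)) [:: b; c] +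
    (inner_swaps (fun u => G (Node u b c)) a + inner_swaps (fun u => G (Node a u c)) b +
     inner_swaps (fun u => G (Node a b u)) c)
  else 0.

Fixpoint swaps f F : R :=
  if F is t :: F' then
    swap_cost f F + inner_swaps (fun u => f (u :: F')) t + swaps (fun K => f (t :: K)) F'
  else 0.

Lemma inner_swaps_ge0 G t : 0 <= inner_swaps G t.
Proof.
by elim: t G => [|a IHa b IHb c IHc] G //=; rewrite !addr_ge0 ?swap_cost_ge0.
Qed.

Lemma swaps_ge0 f F : 0 <= swaps f F.
Proof.
by elim: F f => [|t F IH] f //=; rewrite !addr_ge0 ?inner_swaps_ge0 ?IH ?swap_cost_ge0.
Qed.

(** The sum [swaps] runs over all transpositions of the word of [F] but is
    defined on trees; prefixing a letter does not affect those further right. *)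
Lemma swaps_grow f F : (2 < size F)%N -> swaps f (grow F) = swaps (f \o grow) F.
Proof.
case: F => [|a [|b [|c F]]] //= _.
have -> : swap_cost f (Node a b c :: F) =
    swap_cost (fun K => f (grow [:: a, b & K])) (c :: F).
  by case: F => [|[|x y z] F].
have -> : swap_cost (f \o grow) [:: a, b, c & F] =
    swap_cost (on_children (fun u => f (u :: F))) [:: a; b; c].
  by case: b.
have -> : swap_cost (fun K => f (grow (a :: K))) [:: b, c & F] =
    swap_cost (fun K => on_children (fun u => f (u :: F)) (a :: K)) [:: b; c].
  by case: c.
by rewrite /=; ring.
Qed.

Lemma fsum_swaps0 m f : fsum m.+1 0 (swaps f) = fsum m 2 (swaps (f \o grow)).
Proof.
by rewrite fsumS0; apply: eq_fsum => F sF; rewrite -swaps_grow ?sF.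
Qed.

(** By first letter, plus the transpositions of the first two letters. *)
Lemma fsum_swapsS m h f : fsum m.+1 h.+1 (swaps f) =
  fsum m h.+3 (swaps (f \o grow)) + fsum m h (swaps (f \o cons Leaf)) +
  fsum m h (fun F => swap_cost f (Leaf :: F)).
Proof.
rewrite fsumSS -addrA; congr (_ + _).
  by apply: eq_fsum => F sF; rewrite -swaps_grow ?sF.
by rewrite -fsumD; apply: eq_fsum => F _; rewrite /= addr0 addrC.
Qed.

Lemma fsum_swap_cost m h f : fsum m.+1 h (fun F => swap_cost f (Leaf :: F)) =
  fsum m h.+2 (fun F => (f (Leaf :: grow F) - f (grow (Leaf :: F))) ^+ 2).
Proof.
have gE : fsum m h.+2 ((fun F => swap_cost f (Leaf :: F)) \o grow) =
    fsum m h.+2 (fun F => (f (Leaf :: grow F) - f (grow (Leaf :: F))) ^+ 2).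
  by apply: eq_fsum => -[|a [|b [|c F]]].
case: h gE => [|h] gE; first by rewrite fsumS0 gE.
by rewrite fsumSS gE [X in _ + X](_ : _ = 0) ?addr0 //; apply: big1.
Qed.

Definition fmean m h f : R := fsum m h f / (count_forests m h)%:R.

Lemma sqr_fsum_le m h f :
  (fsum m h f) ^+ 2 <= (count_forests m h)%:R * fsum m h (fun F => f F ^+ 2).
Proof.
rewrite /fsum /count_forests; elim: (forests m h) => [|F s IH] /=.
  by rewrite !big_nil expr0n mulr0.
rewrite !big_cons -natr1.
set a := f F; set S := \sum_(j <- s) f j in IH *.
set Q := \sum_(j <- s) _ in IH *; set n : R := (size s)%:R in IH *.
have n0 : 0 <= n by [].
have [n00|n_gt0] := eqVneq n 0.
  have S0 : S = 0.
    by apply/eqP; rewrite -sqrf_eq0 eq_le sqr_ge0 andbT (le_trans IH) // n00 mul0r.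
  have Q0 : 0 <= Q by apply: sumr_ge0 => j _; apply: sqr_ge0.
  rewrite n00 S0; nra.
have np : 0 < n by rewrite lt_def n_gt0.
have key : 2 * a * S <= n * a ^+ 2 + Q.
  rewrite -(ler_pM2l np).
  have := sqr_ge0 (n * a - S); nra.
nra.
Qed.

Lemma sqr_split_le (k s r x y : R) : 0 <= k -> 0 <= y ->
  s ^+ 2 <= x -> r ^+ 2 <= k * y -> (s + r) ^+ 2 <= (k + 1) * (x + y).
Proof.
move=> k0 y0 sx ry.
have key : 2 * s * r <= k * x + y.
  have [k00|kn0] := eqVneq k 0.
    have -> : r = 0.
      by apply/eqP; rewrite -sqrf_eq0 eq_le sqr_ge0 andbT (le_trans ry) // k00 mul0r.
    by rewrite k00 mulr0 mul0r add0r.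
  have kp : 0 < k by rewrite lt_def kn0.
  rewrite -(ler_pM2l kp); have := sqr_ge0 (k * s - r).
  have : k ^+ 2 * s ^+ 2 <= k ^+ 2 * x by rewrite ler_wpM2l ?sqr_ge0.
  nra.
nra.
Qed.

(** With [a], [e], [c] the numbers of completions at heights h + 5, h + 2 and
    h - 1, the difference of means is s + p dU + q dD, where s compares the
    completions of the two transposed pairs of letters, dU and dD are differences
    of the same kind after one more common letter, p = a / (a + e) and
    q = c / (e + c).  Log-concavity says p + q <= 1, so the induction closes by
    convexity, with one more unit in the constant. *)
Lemma swap_gap m h f :
  (0 < count_forests m h.+3)%N -> (0 < count_forests m h)%N ->
  (fmean m h.+3 (f \o grow) - fmean m h (f \o cons Leaf)) ^+ 2 <=
  m%:R * ((count_forests m h.+3)%:R^-1 + (count_forests m h)%:R^-1) *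
  fsum m.+1 h.+1 (swaps f).
Proof.
elim: m h f => [|m IH] h f; first by [].
rewrite fsum_swapsS fsum_swap_cost.
set DU := fsum _ _ (swaps (f \o grow)); set DD := fsum _ _ (swaps (f \o cons Leaf)).
set S0 := fsum m _ _.
rewrite /fmean fsumSS.
set A := fsum m _ ((_ \o _) \o grow); set B := fsum m _ ((_ \o _) \o cons Leaf).
rewrite !count_forestsS.
pose c' : nat := if h is h'.+1 then count_forests m h' else 0%N.
pose C := if h is h'.+1 then fsum m h' ((f \o cons Leaf) \o cons Leaf) else 0.
pose B' := fsum m h.+2 ((f \o cons Leaf) \o grow).
have -> : fsum m.+1 h (f \o cons Leaf) = B' + C.
  by rewrite /B' /C; case: (h) => [|h']; rewrite ?fsumS0 ?addr0 ?fsumSS.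
have -> : count_forests m.+1 h = (count_forests m h.+2 + c')%N.
  by rewrite /c'; case: (h) => [|h']; rewrite ?count_forests0 ?addn0 ?count_forestsS.
set a' := count_forests m h.+3.+2; set e' := count_forests m h.+2.
move=> u0 d0.
have lc : (a' * c' <= e' * e')%N.
  rewrite /c' /a' /e'; case: (h) => [|h']; first by rewrite muln0.
  have := count_forests_logconcave m h' 0.
  rewrite muln0 addn0 mulnC.
  by rewrite (_ : (h' + 6 = h'.+1.+3.+2)%N) 1?(_ : (h' + 3 = h'.+1.+2)%N) //; lia.
have e'0 : (0 < e')%N by rewrite lt0n; apply/eqP => e00; nia.
pose a : R := a'%:R; pose e : R := e'%:R; pose c : R := c'%:R.
have a0 : 0 <= a by []. have c0 : 0 <= c by [].
have e0 : 0 < e by rewrite ltr0n.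
have lcR : a * c <= e * e by rewrite -!natrM ler_nat.
pose dU := A / a - B / e; pose dD := B' / e - C / c.
pose p := a / (a + e); pose q := c / (e + c).
have ae0 : 0 < a + e by rewrite ltr_wpDl.
have ec0 : 0 < e + c by rewrite ltr_pwDl.
have Aa : A = a * (A / a).
  have [a00|an0] := eqVneq a 0; last by rewrite mulrC divfK.
  by rewrite a00 mul0r; apply: fsum_empty; apply/eqP; rewrite -(eqr_nat R) -/a' -/a a00.
have Cc : C = c * (C / c).
  have [c00|cn0] := eqVneq c 0; last by rewrite mulrC divfK.
  rewrite c00 mul0r /C; move: c00; rewrite /c /c'; case: (h) => [//|h'] c00.
  by apply: fsum_empty; apply/eqP; rewrite -(eqr_nat R) c00.
have -> : (A + B) / (a' + e')%:R - (B' + C) / (e' + c')%:R =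
    (B - B') / e + (p * dU + q * dD).
  rewrite !natrD -/a -/e -/c {1}Aa {1}Cc /p /q /dU /dD.
  move: (A / a) (C / c) => A' C'; field.
  by rewrite !gt_eqF.
have DU0 : 0 <= DU by apply: fsum_ge0 => F; apply: swaps_ge0.
have DD0 : 0 <= DD by apply: fsum_ge0 => F; apply: swaps_ge0.
have pU : p * dU ^+ 2 <= m%:R * (DU / e).
  have [a00|an0] := eqVneq a' 0%N.
    by rewrite /p /a a00 !mul0r mulr_ge0 // divr_ge0 // ltW.
  have ap : 0 < a by rewrite ltr0n lt0n.
  have := IH h.+2 (f \o grow); rewrite -/a' -/e' lt0n => /(_ an0 e'0).
  rewrite /fmean -/A -/B -/a' -/e' -/a -/e -/dU -/DU => IHU.
  have -> : m%:R * (DU / e) = p * (m%:R * (a^-1 + e^-1) * DU).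
    by rewrite /p; field; rewrite !gt_eqF.
  by rewrite ler_wpM2l // divr_ge0 // ltW.
have qD : q * dD ^+ 2 <= m%:R * (DD / e).
  have [c00|cn0] := eqVneq c' 0%N.
    by rewrite /q /c c00 !mul0r mulr_ge0 // divr_ge0 // ltW.
  have cp : 0 < c by rewrite ltr0n lt0n.
  have IHD : dD ^+ 2 <= m%:R * (e^-1 + c^-1) * DD.
    move: cn0 e'0; rewrite /dD /DD /c /B' /C /c' /e /e'.
    case: (h) => [//|h'] cn0 e'0'.
    by apply: IH; rewrite // lt0n.
  have -> : m%:R * (DD / e) = q * (m%:R * (e^-1 + c^-1) * DD).
    by rewrite /q; field; rewrite !gt_eqF.
  by rewrite ler_wpM2l // divr_ge0 // ltW.
(* This is p + q <= 1, in the form that bounds 1 / e by the sum of the two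
   reciprocals in the conclusion. *)
have pq1 : 1 <= (a + e)^-1 * e + (e + c)^-1 * e.
  have -> : (a + e)^-1 * e + (e + c)^-1 * e = 1 + (e * e - a * c) / ((a + e) * (e + c)).
    by field; rewrite !gt_eqF.
  by rewrite lerDl divr_ge0 ?subr_ge0 // mulr_ge0 // ltW.
have p0 : 0 <= p by rewrite divr_ge0 // ltW.
have q0 : 0 <= q by rewrite divr_ge0 // ltW.
have pqle : p + q <= 1.
  suff -> : p + q = 2 - ((a + e)^-1 * e + (e + c)^-1 * e) by lra.
  by rewrite /p /q; field; rewrite !gt_eqF.
have r2 : (p * dU + q * dD) ^+ 2 <= m%:R * ((DU + DD) / e).
  rewrite mulrDl mulrDr; apply: le_trans (lerD pU qD).
  set u := dU; set v := dD.
  have h1 : 0 <= (1 - p - q) * (p * u ^+ 2 + q * v ^+ 2).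
    rewrite mulr_ge0 //; last by rewrite addr_ge0 // mulr_ge0 ?sqr_ge0.
    by rewrite -addrA -opprD subr_ge0.
  have h2 : 0 <= p * q * (u - v) ^+ 2 by rewrite mulr_ge0 ?sqr_ge0 // mulr_ge0.
  rewrite -subr_ge0.
  by have -> : p * u ^+ 2 + q * v ^+ 2 - (p * u + q * v) ^+ 2 =
    (1 - p - q) * (p * u ^+ 2 + q * v ^+ 2) + p * q * (u - v) ^+ 2;
    [ring | rewrite addr_ge0].
have S00 : 0 <= S0 by apply: fsum_ge0 => F; apply: sqr_ge0.
have s2 : ((B - B') / e) ^+ 2 <= S0 / e.
  have BB : B - B' = fsum m h.+2 (fun F => f (grow (Leaf :: F)) - f (Leaf :: grow F)).
    rewrite (fsumD _ _ _ (fun F => - f (Leaf :: grow F))) /B /B'; congr (_ + _).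
    by rewrite /fsum sumrN.
  rewrite expr_div_n ler_pdivrMr ?exprn_gt0 // BB.
  apply: le_trans (sqr_fsum_le _ _ _) _; rewrite -/e' -/e.
  have -> : S0 / e * e ^+ 2 = e * S0 by field; rewrite gt_eqF.
  rewrite ler_pM2l //; apply: ler_fsum => F _; by rewrite -sqrrN opprB.
have DDe : 0 <= (DU + DD) / e by rewrite divr_ge0 ?addr_ge0 // ltW.
apply: le_trans (sqr_split_le _ DDe s2 r2) _ => //.
rewrite natr1 -mulrA ler_wpM2l // !natrD -/a -/e -/c.
have -> : S0 / e + (DU + DD) / e = e^-1 * (DU + DD + S0) by ring.
rewrite ler_wpM2r ?addr_ge0 // -(ler_pM2r e0) mulVf ?gt_eqF // mulrDl.
exact: pq1.
Qed.

(** The number of forests times the variance under the uniform distribution. *)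
Definition fvar m h f : R :=
  fsum m h (fun F => f F ^+ 2) - (fsum m h f) ^+ 2 / (count_forests m h)%:R.

Lemma fvar_split m h f :
  (0 < count_forests m h.+3)%N -> (0 < count_forests m h)%N ->
  fvar m.+1 h.+1 f <= fvar m h.+3 (f \o grow) + fvar m h (f \o cons Leaf) +
    m%:R * fsum m.+1 h.+1 (swaps f).
Proof.
move=> u0 d0.
have := swap_gap f u0 d0; set S := fsum _ _ (swaps f).
rewrite /fvar !fsumSS count_forestsS /fmean.
set u : R := (count_forests m h.+3)%:R; set d : R := (count_forests m h)%:R.
have up : 0 < u by rewrite ltr0n.
have dp : 0 < d by rewrite ltr0n.
rewrite natrD -/u -/d.
set A := fsum m h.+3 (f \o grow); set B := fsum m h (f \o cons Leaf).
set A2 := fsum m h.+3 _; set B2 := fsum m h _ => gap.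
have -> : A2 + B2 - (A + B) ^+ 2 / (u + d) = A2 - A ^+ 2 / u + (B2 - B ^+ 2 / d) +
    (u * d) / (u + d) * (A / u - B / d) ^+ 2.
  by field; rewrite !gt_eqF // addr_gt0.
rewrite lerD2l.
have w0 : 0 <= (u * d) / (u + d) by rewrite divr_ge0 ?addr_ge0 ?mulr_ge0 // ltW.
apply: le_trans (ler_wpM2l w0 gap) _.
rewrite le_eqVlt; apply/orP; left; apply/eqP.
by field; rewrite !gt_eqF // addr_gt0.
Qed.

(** Revealing the first letter splits the variance into two variances for shorter
    words and a squared difference of means, which [swap_gap] bounds by m times
    the sum of the swaps; summing the m's gives the square. *)
Lemma fvar_le m h f : fvar m h f <= m%:R ^+ 2 * fsum m h (swaps f).
Proof.
have step m' (x : R) : 0 <= x -> m'%:R ^+ 2 * x + m'%:R * x <= m'.+1%:R ^+ 2 * x.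
  by move=> x0; rewrite -mulrDl ler_wpM2r // -natr1; have : 0 <= m'%:R :> R by []; nra.
have step' m' (x : R) : 0 <= x -> m'%:R ^+ 2 * x <= m'.+1%:R ^+ 2 * x.
  by move=> x0; apply: le_trans (step _ _ x0); rewrite lerDl mulr_ge0.
have sw0 m' h' g : 0 <= fsum m' h' (swaps g).
  by apply: fsum_ge0 => F; apply: swaps_ge0.
have cr0 m' h' g : 0 <= fsum m' h' (fun F => swap_cost g (Leaf :: F)).
  by apply: fsum_ge0 => F; apply: swap_cost_ge0.
have fvar0 m' h' g : count_forests m' h' = 0%N -> fvar m' h' g = 0.
  by move=> c0; rewrite /fvar !fsum_empty // expr0n mul0r subr0.
elim: m h f => [|m IH] [|h] f.
- by rewrite expr0n mul0r /fvar /fsum /= !big_seq1 /count_forests divr1 subrr.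
- by rewrite fvar0 // fsum0S mulr0.
- have -> : fvar m.+1 0 f = fvar m 2 (f \o grow).
    by rewrite /fvar !fsumS0 count_forests0.
  by rewrite fsum_swaps0; apply: le_trans (IH _ _) (step' _ _ _).
have [u0|u0] := posnP (count_forests m h.+3).
  have -> : fvar m.+1 h.+1 f = fvar m h (f \o cons Leaf).
    by rewrite /fvar !fsumSS count_forestsS u0 !(fsum_empty _ u0) !add0r add0n.
  apply: le_trans (IH _ _) _; apply: le_trans (step' _ _ (sw0 _ _ _)) _.
  rewrite ler_wpM2l ?sqr_ge0 // fsum_swapsS -addrA (addrCA (fsum m h.+3 _)).
  by rewrite lerDl addr_ge0.
have [d0|d0] := posnP (count_forests m h).
  have -> : fvar m.+1 h.+1 f = fvar m h.+3 (f \o grow).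
    by rewrite /fvar !fsumSS count_forestsS d0 !(fsum_empty _ d0) !addr0 addn0.
  apply: le_trans (IH _ _) _; apply: le_trans (step' _ _ (sw0 _ _ _)) _.
  by rewrite ler_wpM2l ?sqr_ge0 // fsum_swapsS -addrA lerDl addr_ge0.
apply: le_trans (fvar_split f u0 d0) _.
apply: le_trans (step _ _ (sw0 _ _ _)); rewrite lerD2r.
apply: le_trans (lerD (IH _ _) (IH _ _)) _.
by rewrite -mulrDr ler_wpM2l ?sqr_ge0 // [leRHS]fsum_swapsS lerDl.
Qed.
(** * From transpositions to rotations *)
Definition rotate_cost f F : R :=
  if F is [:: a, Node x y z & F'] then
    (f F - f [:: Node a x y, z & F']) ^+ 2
  else 0.
Arguments rotate_cost : simpl never.

(** The rotations that take a third child up along the chain of third children. *)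
Fixpoint spine_rotations G t : R :=
  if t is Node a b c then
    (if c is Node r x y then (G t - G (Node (Node a b r) x y)) ^+ 2 else 0) +
    spine_rotations (fun u => G (Node a b u)) c
  else 0.

(** The chains of third children of the first and second children are exactly
    those that transpositions climb; listing them at the parent of their top node
    counts each rotation at most once for the climbs. *)
Fixpoint rotation_sum G t : R :=
  if t is Node a b c then
    let f := on_children G in
    rotate_cost f [:: a; b; c] + rotate_cost (fun F => f (a :: F)) [:: b; c] +
    (spine_rotations (fun u => G (Node u b c)) a + spine_rotations (fun u => G (Node a u c)) b) +
    (rotation_sum (fun u => G (Node u b c)) a + rotation_sum (fun u => G (Node a u c)) b +
     rotation_sum (fun u => G (Node a b u)) c)
  else 0.

Lemma rotate_cost_ge0 f F : 0 <= rotate_cost f F.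
Proof. by rewrite /rotate_cost; case: F => [|a [|[|x y z] F]] //; rewrite sqr_ge0. Qed.

Lemma spine_rotations_ge0 G t : 0 <= spine_rotations G t.
Proof.
elim: t G => [|a _ b _ c IHc] G //=; rewrite addr_ge0 //.
by case: (c) => // *; rewrite sqr_ge0.
Qed.

Lemma rotation_sum_ge0 G t : 0 <= rotation_sum G t.
Proof.
by elim: t G => [|a IHa b IHb c IHc] G //=;
  rewrite !addr_ge0 ?rotate_cost_ge0 ?spine_rotations_ge0.
Qed.

(** The two ends of the climb of a node from the bottom of the third-child chain
    of [a] to its top. *)
Definition graft_cost f F : R :=
  if F is [:: a, x, y & F'] then
    (f (graft a (Node Leaf x y) :: F') - f (Node a x y :: F')) ^+ 2
  else 0.
Arguments graft_cost : simpl never.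

Definition on_head (A : (tree -> R) -> tree -> R) f F : R :=
  if F is t :: F' then A (fun u => f (u :: F')) t else 0.

(** Functionals on forests are moved past the first [k] trees, so that inductions
    on words may open these trees letter by letter. *)
Definition at_index (A : (seq tree -> R) -> seq tree -> R) k f F : R :=
  A (fun K => f (take k F ++ K)) (drop k F).

Definition grow_at k F := take k F ++ grow (drop k F).

Lemma at0 A f F : at_index A 0 f F = A f F.
Proof. by rewrite /at_index take0 drop0. Qed.

Lemma at_grow A k f F : (2 < size F)%N ->
  at_index A k.+1 f (grow F) = at_index A k.+3 (f \o grow) F.
Proof. by case: F => [|a [|b [|c F]]]. Qed.

Lemma on_head_ge0 (A : (tree -> R) -> tree -> R) f F :
  (forall G t, 0 <= A G t) -> 0 <= on_head A f F.
Proof. by case: F => /=. Qed.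

Lemma fsum_peel A m h k f : fsum m.+1 h.+1 (at_index A k.+1 f) =
  fsum m h.+3 (at_index A k.+3 (f \o grow)) +
  fsum m h (at_index A k (f \o cons Leaf)).
Proof.
by rewrite fsumSS; congr (_ + _); apply: eq_fsum => F sF; rewrite /= at_grow ?sF.
Qed.

Lemma fsum_grow_at m h k (g : seq tree -> R) : (k <= h)%N ->
  fsum m.+1 h (fun F => if nth Leaf F k is Node _ _ _ then g F else 0) =
  fsum m h.+2 (g \o grow_at k).
Proof.
have part1 m' h' (g' : seq tree -> R) :
    fsum m' h'.+2 ((fun F => if nth Leaf F 0 is Node _ _ _ then g' F else 0) \o grow) =
    fsum m' h'.+2 (g' \o grow_at 0).
  by apply: eq_fsum => -[|a [|b [|c F]]].
elim: m h k g => [|m IH] h [|k] g.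
- case: h => [|h] _; first by rewrite fsumS0 part1.
  by rewrite fsumSS part1 [X in _ + X](_ : _ = 0) ?addr0 //; apply: big1.
- case: h => // h _; rewrite fsumSS !fsum0S add0r.
  case: h => [|h]; last exact: fsum0S.
  by rewrite /fsum /= big_seq1 /=; case: (k) => [|k'] //=; rewrite nth_nil.
- case: h => [|h] _; first by rewrite fsumS0 part1.
  by rewrite fsumSS part1 [X in _ + X](_ : _ = 0) ?addr0 //; apply: big1.
case: h => // h kh; rewrite fsumSS [RHS]fsumSS -(IH _ k (g \o cons Leaf)) //.
congr (_ + _); transitivity (fsum m h.+3.+2 ((g \o grow) \o grow_at k.+3)).
  by rewrite -IH //; apply: eq_fsum => -[|a [|b [|c F]]].
by apply: eq_fsum => -[|a [|b [|c F]]].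
Qed.

Lemma fsum_grow_at_le m h k (g : seq tree -> R) : (k <= h)%N ->
  (forall F, 0 <= g F) -> fsum m h.+2 (g \o grow_at k) <= fsum m.+1 h g.
Proof.
move=> kh g0; rewrite -fsum_grow_at //; apply: ler_fsum => F _.
by case: nth.
Qed.

Lemma sqr_split (k x y z : R) : 0 < k ->
  (x - z) ^+ 2 <= (1 + k^-1) * (x - y) ^+ 2 + (k + 1) * (y - z) ^+ 2.
Proof.
move=> k0; rewrite -subr_ge0.
have -> : (1 + k^-1) * (x - y) ^+ 2 + (k + 1) * (y - z) ^+ 2 - (x - z) ^+ 2 =
   ((x - y) - k * (y - z)) ^+ 2 / k by field; rewrite gt_eqF.
by rewrite divr_ge0 ?sqr_ge0 // ltW.
Qed.

(** Removing the top node of the chain of [a] shortens the climb by one rotation;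
    [sqr_split] with weight m + 1 pays for it and keeps the constant linear.
    The rotations met at different stages come from different forests
    ([fsum_grow_at_le]), which is why their costs add up without multiplicity. *)
Lemma graft_cost_le m h k f : (k <= h)%N ->
  fsum m h.+2 (at_index graft_cost k f) <=
  m.+1%:R * fsum m.+1 h (at_index (on_head spine_rotations) k f).
Proof.
have C0 m' h' k' f' : 0 <= fsum m' h' (at_index (on_head spine_rotations) k' f').
  by apply: fsum_ge0 => F; apply: on_head_ge0 => *; apply: spine_rotations_ge0.
elim: m h k f => [|m IH] h k f kh.
  by rewrite fsum0S mulr_ge0.
have stepC m' h' k' f' : m'.+1%:R * fsum m'.+1 h' (at_index (on_head spine_rotations) k' f') <=
    m'.+2%:R * fsum m'.+1 h' (at_index (on_head spine_rotations) k' f').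
  by rewrite ler_wpM2r // ler_nat.
case: k kh => [|k] kh; last first.
  case: h kh => // h kh; rewrite fsum_peel [fsum m.+2 _ _]fsum_peel mulrDr.
  by apply: lerD; apply: le_trans (IH _ _ _ _) (stepC _ _ _ _).
pose rot F : R := if F is [:: u, v, Node a x y & F'] then
  (f (Node u v (Node a x y) :: F') - f (Node (Node u v a) x y :: F')) ^+ 2 else 0.
have rot0 F : 0 <= rot F.
  by rewrite /rot; move: F => [|u [|v [|[|a x y] F]]] //; apply: sqr_ge0.
have lhsE : fsum m.+1 h.+2 (at_index graft_cost 0 f) =
    fsum m h.+2.+2 ((at_index graft_cost 0 f) \o grow).
  rewrite fsumSS [X in _ + X](_ : _ = 0) ?addr0 //; apply: big1 => F _.
  by rewrite /= at0 /graft_cost; move: F => [|x [|y F]] //; rewrite subrr expr0n.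
have rhsE : fsum m.+1 h.+2 (fun F => rot F + at_index (on_head spine_rotations) 2 (f \o grow) F) <=
    fsum m.+2 h (at_index (on_head spine_rotations) 0 f).
  have -> : fsum m.+1 h.+2 (fun F => rot F + at_index (on_head spine_rotations) 2 (f \o grow) F)
      = fsum m.+1 h.+2 (at_index (on_head spine_rotations) 0 f \o grow).
    apply: eq_fsum => -[|u [|v [|c F]]] //= _.
    by rewrite !at0 /at_index /=; case: c.
  case: (h) => [|h']; first by rewrite [leRHS]fsumS0.
  rewrite [leRHS]fsumSS lerDl; apply: fsum_ge0 => F.
  by apply: on_head_ge0 => *; apply: spine_rotations_ge0.
rewrite lhsE; apply: le_trans _ (ler_wpM2l _ rhsE) => //.
have m0 : 0 < m.+1%:R :> R by rewrite ltr0Sn.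
have stepF F : size F = h.+2.+3 -> (at_index graft_cost 0 f \o grow) F <=
    (1 + m.+1%:R^-1) * at_index graft_cost 2 (f \o grow) F + (m.+1%:R + 1) * (rot \o grow_at 2) F.
  move: F => [|u [|v [|a [|x [|y F]]]]] //= _.
  by rewrite at0 /graft_cost /at_index /= /graft_cost /=; apply: sqr_split.
apply: le_trans (ler_fsum m stepF) _.
rewrite !fsumD !fsumZ natr1 mulrDr addrC; apply: lerD.
  by rewrite ler_wpM2l //; apply: fsum_grow_at_le.
apply: le_trans (ler_wpM2l _ (IH h.+2 2%N _ _)) _ => //.
rewrite mulrA mulrDl mul1r mulVf ?gt_eqF // natr1.
by rewrite lexx.
Qed.

(** A transposition is one rotation between two neighbouring trees followed by a
    climb down the chain of the first. *)
Lemma swap_cost_le m h k f : (k < h)%N ->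
  fsum m h (at_index swap_cost k f) <=
  2 * fsum m h (at_index rotate_cost k f) +
  (2 * m)%:R * fsum m h (at_index (on_head spine_rotations) k f).
Proof.
case: m => [|m]; first by case: h => // h; rewrite !fsum0S !mulr0 addr0.
move=> kh.
have second_node (A : (seq tree -> R) -> seq tree -> R) :
    (forall g F, (if nth Leaf F 1 is Leaf then true else false) -> A g F = 0) ->
    fsum m.+1 h (at_index A k f) = fsum m h.+2 (at_index A k f \o grow_at k.+1).
  move=> A0; rewrite -fsum_grow_at //; apply: eq_fsum => F sF.
  case E: (nth Leaf F k.+1) => //; apply: A0.
  by rewrite nth_drop addn1 E.
rewrite (second_node swap_cost) ?(second_node rotate_cost); last 2 first.
- by move=> g [|a [|[|x y z] F]].
- by move=> g [|a [|[|x y z] F]].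
have stepF F : size F = h.+3 -> (at_index swap_cost k f \o grow_at k.+1) F <=
    2 * (at_index rotate_cost k f \o grow_at k.+1) F + 2 * at_index graft_cost k f F.
  move=> sF.
  have tk : size (take k F) = k by rewrite size_takel // sF; lia.
  have sd : size (drop k F) = (h.+3 - k)%N by rewrite size_drop sF.
  have [a [x [y [z [F' FE]]]]] : exists a x y z F', drop k F = [:: a, x, y, z & F'].
    case: (drop k F) sd => [|a [|x [|y [|z F']]]] /= sd; try lia.
    by exists a, x, y, z, F'.
  have -> : F = take k F ++ [:: a, x, y, z & F'] by rewrite -FE cat_take_drop.
  move: (take k F) tk => p tk.
  have tp u v : take k (p ++ u :: v) = p by rewrite take_cat tk ltnn subnn cats0.
  have dp u v : drop k (p ++ u :: v) = u :: v by rewrite drop_cat tk ltnn subnn drop0.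
  rewrite /= /at_index.
  have -> : grow_at k.+1 (p ++ [:: a, x, y, z & F']) = p ++ [:: a, Node x y z & F'].
    rewrite /grow_at take_cat drop_cat tk ltnNge leqnSn /= subSnn /=.
    by rewrite -?catA ?take0 ?drop0.
  rewrite !tp !dp /swap_cost /rotate_cost /graft_cost.
  set u := f _; set v := f _; set w := f _.
  by have := sqr_ge0 ((u - w) - (w - v)); nra.
apply: le_trans (ler_fsum m stepF) _.
rewrite fsumD !fsumZ lerD2l natrM -mulrA ler_wpM2l //.
exact: (graft_cost_le m f (ltnW kh)).
Qed.

Lemma inner_swaps_le m h k f : (k <= h)%N ->
  fsum m h (at_index (on_head inner_swaps) k f) <=
  (2 * m.+1)%:R * fsum m h (at_index (on_head rotation_sum) k f).
Proof.
have R0 m' h' k' f' : 0 <= fsum m' h' (at_index (on_head rotation_sum) k' f').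
  by apply: fsum_ge0 => F; apply: on_head_ge0 => *; apply: rotation_sum_ge0.
have C0 m' h' k' f' : 0 <= fsum m' h' (at_index (on_head spine_rotations) k' f').
  by apply: fsum_ge0 => F; apply: on_head_ge0 => *; apply: spine_rotations_ge0.
have F0 m' h' k' f' : 0 <= fsum m' h' (at_index rotate_cost k' f').
  by apply: fsum_ge0 => F; apply: rotate_cost_ge0.
elim: m h k f => [|m IH] h k f kh.
  case: h kh => [|h]; last by rewrite !fsum0S mulr0.
  by case: k => // _; rewrite /fsum !big_seq1 !at0 /= mulr0.
have IH' h' k' f' : (k' <= h')%N ->
    fsum m h' (at_index (on_head inner_swaps) k' f') <=
    (2 * m.+2)%:R * fsum m h' (at_index (on_head rotation_sum) k' f').
  move=> /IH; move/(_ f')/le_trans; apply; rewrite ler_wpM2r // ler_nat; lia.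
case: k kh => [|k] kh; last first.
  by case: h kh => // h kh; rewrite !fsum_peel mulrDr; apply: lerD; apply: IH'.
have peel0 (A : (tree -> R) -> tree -> R) : (forall G, A G Leaf = 0) ->
    fsum m.+1 h (at_index (on_head A) 0 f) =
    fsum m h.+2 (at_index (on_head A) 0 f \o grow).
  move=> A0; case: (h) => [|h']; first by rewrite fsumS0.
  rewrite fsumSS [X in _ + X](_ : _ = 0) ?addr0 //; apply: big1 => F _.
  by rewrite /= at0 /= A0.
rewrite !peel0 //.
pose g := f \o grow.
have -> : fsum m h.+2 (at_index (on_head inner_swaps) 0 f \o grow) =
  fsum m h.+2 (fun F => at_index swap_cost 0 g F + at_index swap_cost 1 g F +
    (at_index (on_head inner_swaps) 0 g F + at_index (on_head inner_swaps) 1 g F +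
     at_index (on_head inner_swaps) 2 g F)).
  apply: eq_fsum => -[|a [|b [|c F]]] //= _; rewrite !at0 /at_index /=.
have -> : fsum m h.+2 (at_index (on_head rotation_sum) 0 f \o grow) =
  fsum m h.+2 (fun F => at_index rotate_cost 0 g F + at_index rotate_cost 1 g F +
    (at_index (on_head spine_rotations) 0 g F + at_index (on_head spine_rotations) 1 g F) +
    (at_index (on_head rotation_sum) 0 g F + at_index (on_head rotation_sum) 1 g F +
     at_index (on_head rotation_sum) 2 g F)).
  apply: eq_fsum => -[|a [|b [|c F]]] //= _; rewrite !at0 /at_index /=.
rewrite !fsumD.
have c0 := @swap_cost_le m h.+2 0 g erefl; have c1 := @swap_cost_le m h.+2 1 g erefl.
have i0 := IH' h.+2 0%N g erefl; have i1 := IH' h.+2 1%N g erefl.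
have i2 := IH' h.+2 2%N g erefl.
have := (F0 m h.+2 0%N g, F0 m h.+2 1%N g, C0 m h.+2 0%N g, C0 m h.+2 1%N g).
move: c0 c1 i0 i1 i2.
set x0 := fsum _ _ (at_index swap_cost 0 g); set x1 := fsum _ _ (at_index swap_cost 1 g).
set y0 := fsum _ _ (at_index rotate_cost 0 g); set y1 := fsum _ _ (at_index rotate_cost 1 g).
set z0 := fsum _ _ (at_index (on_head spine_rotations) 0 g).
set z1 := fsum _ _ (at_index (on_head spine_rotations) 1 g).
move=> c0 c1 i0 i1 i2 [[[y00 y10] z00] z10].
rewrite !mulrDr; apply: lerD; last by rewrite !lerD.
have -> : (2 * m.+2)%:R = (2 * m)%:R + 4 :> R by rewrite -natrD; congr _%:R; lia.
have n0 : 0 <= (2 * m)%:R :> R by [].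
by nra.
Qed.

Lemma spine_rotations_le (G : tree -> R) (B : R) t : 0 <= B ->
  (forall t', rotation t t' -> (G t - G t') ^+ 2 <= B) ->
  spine_rotations G t <= (spine t)%:R * B.
Proof.
move=> B0; elim: t G => [|a _ b _ c IHc] G GB /=; first by rewrite mul0r.
rewrite -natr1 mulrDl mul1r addrC; apply: lerD.
  by apply: IHc => t' ct'; apply: GB; apply: Rot3.
by case: (c) GB => // r x y; apply; apply: Rot13.
Qed.

Lemma rotation_sum_le (G : tree -> R) (B : R) t : 0 <= B ->
  (forall t', rotation t t' -> (G t - G t') ^+ 2 <= B) ->
  rotation_sum G t <= (3 * nodes t)%:R * B.
Proof.
move=> B0 GB; suff : rotation_sum G t + (spine t)%:R * B <= (3 * nodes t)%:R * B.
  by apply: le_trans; rewrite lerDl mulr_ge0.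
elim: t G GB => [|a IHa b IHb c IHc] G GB; first by rewrite /= muln0 mul0r addr0.
have Ha t' : rotation a t' -> (G (Node a b c) - G (Node t' b c)) ^+ 2 <= B.
  by move=> r; apply: GB; apply: Rot1.
have Hb t' : rotation b t' -> (G (Node a b c) - G (Node a t' c)) ^+ 2 <= B.
  by move=> r; apply: GB; apply: Rot2.
have Hc t' : rotation c t' -> (G (Node a b c) - G (Node a b t')) ^+ 2 <= B.
  by move=> r; apply: GB; apply: Rot3.
have ca := @spine_rotations_le (fun u => G (Node u b c)) B a B0 Ha.
have cb := @spine_rotations_le (fun u => G (Node a u c)) B b B0 Hb.
have ra := IHa (fun u => G (Node u b c)) Ha.
have rb := IHb (fun u => G (Node a u c)) Hb.
have rc := IHc (fun u => G (Node a b u)) Hc.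
have f1 : rotate_cost (on_children G) [:: a; b; c] <= B.
  by rewrite /rotate_cost; case: (b) GB => // x y z; apply; apply: Rot12.
have f2 : rotate_cost (fun F => on_children G (a :: F)) [:: b; c] <= B.
  by rewrite /rotate_cost; case: (c) GB => // x y z; apply; apply: Rot23.
rewrite [rotation_sum _ _]/= [spine _]/= [nodes _]/= -natr1 mulnS natrD !mulnDr !natrD.
move: f1 f2 ca cb ra rb rc.
set v1 := rotate_cost _ _; set v2 := rotate_cost _ _; set v3 := spine_rotations _ _; set v4 := spine_rotations _ _.
set v5 := rotation_sum _ a; set v6 := rotation_sum _ b; set v7 := rotation_sum _ c.
by nra.
Qed.

Lemma sum_trees n (g : tree -> R) :
  \sum_(t <- trees n) g t = fsum (3 * n) 0 (g \o head Leaf).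
Proof. by rewrite /trees big_map. Qed.

(** The bound [B t] is to be thought of as the local energy at [t], which will
    dominate the squared variation along every flip that starts from [t]. *)
Lemma trees_poincare n (f B : tree -> R) :
  (forall t, 0 <= B t) ->
  (forall t t', nodes t = n -> rotation t t' -> (f t - f t') ^+ 2 <= B t) ->
  \sum_(t <- trees n) f t ^+ 2 - (\sum_(t <- trees n) f t) ^+ 2 / (size (trees n))%:R
  <= (54 * n ^ 3 * (3 * n + 1))%:R * \sum_(t <- trees n) B t.
Proof.
move=> B0 fB; rewrite !sum_trees size_map.
have := @fvar_le (3 * n) 0 (f \o head Leaf); rewrite /fvar => /le_trans; apply.
have -> : fsum (3 * n) 0 (swaps (f \o head Leaf)) =
    fsum (3 * n) 0 (at_index (on_head inner_swaps) 0 (f \o head Leaf)).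
  apply: eq_fsum => -[|t []] //= _.
  by rewrite at0 /swap_cost add0r addr0.
have := @inner_swaps_le (3 * n) 0 0 (f \o head Leaf) (leqnn 0).
move=> /(ler_wpM2l (sqr_ge0 (3 * n)%:R))/le_trans; apply.
have le1 : fsum (3 * n) 0 (at_index (on_head rotation_sum) 0 (f \o head Leaf)) <=
    (3 * n)%:R * fsum (3 * n) 0 (B \o head Leaf).
  rewrite -fsumZ /fsum big_seq [leRHS]big_seq; apply: ler_sum => F.
  rewrite mem_forests => /andP[/eqP sF /eqP zF].
  case: F sF zF => [|t []] //= _ zF; rewrite at0 /=.
  have tn : nodes t = n by lia.
  by rewrite -{1}tn; apply: rotation_sum_le => // t' r; apply: fB.
rewrite mulrA; apply: le_trans (ler_wpM2l _ le1) _ => //.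
rewrite mulrA; apply: ler_wpM2r; first by apply: fsum_ge0 => F; apply: B0.
rewrite -natrX -!natrM ler_nat addn1; rewrite !expnS expn0; nia.
Qed.

End Poincare.

Lemma mem_trees n t : (t \in trees n) = (nodes t == n).
Proof.
apply/mapP/eqP => [[F]|<-].
  rewrite mem_forests => /andP[/eqP sF /eqP zF] ->.
  by case: F sF zF => [|u []] //= _; lia.
by exists [:: t] => //; rewrite mem_forests /=; apply/eqP; lia.
Qed.

Lemma uniq_trees n : uniq (trees n).
Proof.
rewrite map_inj_in_uniq ?uniq_forests // => F K /size_forests + /size_forests.
by case: F => [|t []] //; case: K => [|u []] //= _ _ ->.
Qed.

Lemma size_trees_le n : (size (trees n) <= 2 ^ (3 * n))%N.
Proof. by rewrite size_map count_forests_le. Qed.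

(** * The edges coded by a ternary tree *)
Section Edges.
Local Open Scope nat_scope.

(** The tree [t] with [k] nodes spans the points m, ..., m + k.  In terms of the
    dual quadrangulation, [d] tells whether the side above [t] starts at a point
    or at a gap.  The root edge starts at the first point when [d] holds and ends
    at the last point otherwise; the second child lies between a gap and a point
    and has the other type. *)
Fixpoint edges (d : bool) (m : nat) (t : tree) : seq (nat * nat) :=
  if t is Node a b c then
    let i := m + nodes a in
    let j := (m + nodes a + nodes b).+1 in
    (if d then (m, j) else (i, j + nodes c)) ::
      edges d m a ++ edges (~~ d) (d + i) b ++ edges d j c
  else [::].

Lemma size_edges d m t : size (edges d m t) = nodes t.
Proof.
by elim: t d m => [|a IHa b IHb c IHc] d m //=; rewrite !size_cat IHa IHb IHc; lia.
Qed.

Lemma edges_range d m t x y :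
  (x, y) \in edges d m t -> [/\ m <= x, x < y & y <= m + nodes t].
Proof.
elim: t d m => [|a IHa b IHb c IHc] d m //=; rewrite in_cons !mem_cat.
case/or4P => [/eqP|/IHa[]|/IHb[]|/IHc[]]; try by split; lia.
by case: d => -[-> ->]; split; lia.
Qed.

Ltac edge_lia d :=
  repeat match goal with x := _ |- _ => subst x end;
  repeat match goal with
  | H : is_true (in_mem _ _) |- _ => case/edges_range: H => ? ? ?
  end;
  destruct d;
  repeat match goal with H : (_, _) = (_, _) |- _ => case: H => ? ? end;
  cbn [negb nat_of_bool] in *; repeat (case: ifP => ?); lia.

Lemma uniq_edges d m t : uniq (edges d m t).
Proof.
elim: t d m => [|a IHa b IHb c IHc] d m //=.
rewrite !cat_uniq IHa IHb IHc !mem_cat andbT /=; apply/and3P; split.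
- by apply/negP; case: d => /or3P[] /edges_range[] /=; lia.
- apply/hasPn => -[x y]; rewrite mem_cat => xy; apply/negP => /edges_range[].
  by case/orP: xy => /edges_range[]; lia.
- apply/hasPn => -[x y] /edges_range[] ? ? ?; apply/negP => /edges_range[].
  by case: (d); lia.
Qed.

Lemma edges_noncrossing d m t x y x' y' :
  (x, y) \in edges d m t -> (x', y') \in edges d m t ->
  x < x' -> x' < y -> y < y' -> False.
Proof.
elim: t d m => [|a IHa b IHb c IHc] d m //=; rewrite !in_cons !mem_cat.
case/or4P => [/eqP E|Ea|Eb|Ec]; case/or4P => [/eqP E'|Ea'|Eb'|Ec'];
  try by [apply: IHa Ea Ea'|apply: IHb Eb Eb'|apply: IHc Ec Ec'].
all: by move=> *; edge_lia d.
Qed.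

(** A two-colouring of the points that only the given edge violates: the two
    sides of the tree without that edge.  It is built from the colouring for the
    child that contains the edge, extended to be constant on what hangs on each
    end of that child. *)
Lemma edges_cut d m t (e : nat * nat) : e \in edges d m t ->
  exists chi : nat -> bool, forall x y : nat, (x, y) \in edges d m t ->
    (chi x != chi y) = ((x, y) == e).
Proof.
elim: t d m => [|a IHa b IHb c IHc] d m //=; rewrite in_cons !mem_cat.
have glue (E : seq (nat * nat)) lo hi base (chi : nat -> bool) :
    e \in E -> (forall x y, (x, y) \in E -> [/\ lo <= x, x < y & y <= hi]) ->
    (forall x y, (x, y) \in E -> (chi x != chi y) = ((x, y) == e)) ->
    let rho x := if lo <= x <= hi then x else base in
    forall x y, ((x, y) \in E) || (rho x == rho y) ->
      (chi (rho x) != chi (rho y)) = ((x, y) == e).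
  move=> eE range chiP rho x y.
  have [xyE _|xyE /= /eqP rxy] := boolP ((x, y) \in E).
    have [? ? ?] := range _ _ xyE; rewrite -chiP // /rho.
    have -> : lo <= x <= hi by lia.
    by have -> : lo <= y <= hi by lia.
  rewrite rxy eqxx; apply/esym/eqP => xye.
  by rewrite xye eE in xyE.
have use (E : seq (nat * nat)) (lo hi base : nat) : e \in E ->
    (forall x y, (x, y) \in E -> [/\ lo <= x, x < y & y <= hi]) ->
    (exists chi : nat -> bool, forall x y, (x, y) \in E -> (chi x != chi y) = ((x, y) == e)) ->
    (forall x y, (x, y) \in edges d m (Node a b c) -> ((x, y) \in E) ||
      ((if lo <= x <= hi then x else base) == (if lo <= y <= hi then y else base))) ->
    exists chi : nat -> bool, forall x y, (x, y) \in edges d m (Node a b c) ->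
      (chi x != chi y) = ((x, y) == e).
  move=> eE range [chi chiP] other.
  exists (fun x => chi (if lo <= x <= hi then x else base)) => x y xy.
  exact: (glue E lo hi base chi eE range chiP x y (other x y xy)).
set i := m + nodes a; set j := (i + nodes b).+1.
case/or4P => [/eqP ->|ea|eb|ec].
- exists (fun x => if d then x <= i else x < j) => x y.
  rewrite in_cons !mem_cat => /or4P[/eqP E|Ea|Eb|Ec].
  + by rewrite -E eqxx negb_eqb; clear use; edge_lia d.
  1-3: rewrite negb_eqb (_ : (_ == _) = false); [edge_lia d|apply/eqP => E; edge_lia d].
- apply: (use _ m i (if d then m else i) ea); first by move=> x y /edges_range[].
    exact: IHa.
  move=> x y; rewrite in_cons !mem_cat => /or4P[/eqP E|->//|Eb|Ec].
  1-3: apply/orP; right; apply/eqP; edge_lia d.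
- apply: (use _ (d + i) (d + i + nodes b) (if d then j else i) eb);
    first by move=> x y /edges_range[].
    exact: IHb.
  move=> x y; rewrite in_cons !mem_cat => /or4P[/eqP E|Ea|->|Ec]; rewrite ?orbT //.
  1-3: apply/orP; right; apply/eqP; edge_lia d.
- apply: (use _ j (j + nodes c) (if d then j else j + nodes c) ec);
    first by move=> x y /edges_range[].
    exact: IHc.
  move=> x y; rewrite in_cons !mem_cat => /or4P[/eqP E|Ea|Eb|->]; rewrite ?orbT //.
  1-3: apply/orP; right; apply/eqP; edge_lia d.
Qed.

Inductive reach (T : Type) (e : T -> T -> Prop) (x : T) : T -> Prop :=
| reach_refl : reach e x x
| reach_step y z : reach e x y -> e y z -> reach e x z.

Lemma reach_trans T (e : T -> T -> Prop) x y z :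
  reach e x y -> reach e y z -> reach e x z.
Proof. by move=> xy; elim=> // p q _ xp /(reach_step xp). Qed.

Lemma reach_one (T : Type) (e : T -> T -> Prop) x y : e x y -> reach e x y.
Proof. exact/reach_step/reach_refl. Qed.

Lemma reach_sym T (e : T -> T -> Prop) x y :
  (forall p q, e p q -> e q p) -> reach e x y -> reach e y x.
Proof.
move=> es; elim=> [|p q _ IH /es qp]; first exact: reach_refl.
exact: reach_trans (reach_one qp) IH.
Qed.

Lemma reach_image T U (e : T -> T -> Prop) (e' : U -> U -> Prop) (f : T -> U) x y :
  (forall p q, e p q -> f p = f q \/ e' (f p) (f q)) ->
  reach e x y -> reach e' (f x) (f y).
Proof.
move=> ee'; elim=> [|p q _ IH /ee'[<-//|]]; first exact: reach_refl.
exact: reach_step.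
Qed.

Lemma reach_sub T (e e' : T -> T -> Prop) x y :
  (forall p q, e p q -> e' p q) -> reach e x y -> reach e' x y.
Proof. by move=> ee'; apply: (reach_image (f := id)) => p q /ee'; right. Qed.

Lemma reach_exit T (e : T -> T -> Prop) (chi : T -> bool) x y :
  reach e x y -> chi x != chi y ->
  exists p q, [/\ reach e x p, e p q, chi p = chi x & chi q != chi x].
Proof.
elim=> [|p q xp IH pq]; first by rewrite eqxx.
have [xp'|xp' _] := eqVneq (chi x) (chi p); last exact: IH.
by rewrite eq_sym => xq; exists p, q.
Qed.

Definition linked (E : seq (nat * nat)) x y := (x, y) \in E \/ (y, x) \in E.

Lemma linked_sym E x y : linked E x y -> linked E y x.
Proof. by case; [right|left]. Qed.

Lemma edges_connected d m t x y :
  m <= x <= m + nodes t -> m <= y <= m + nodes t ->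
  reach (linked (edges d m t)) x y.
Proof.
elim: t d m x y => [|a IHa b IHb c IHc] d m x y /= xr yr.
  by rewrite (_ : x = y); [exact: reach_refl | lia].
set i := m + nodes a; set j := (i + nodes b).+1; set E := _ :: _.
have sub E' p q : {subset E' <= E} -> reach (linked E') p q -> reach (linked E) p q.
  by move=> s; apply: reach_sub => u v [/s|/s]; [left|right].
have sym p q : reach (linked E) p q -> reach (linked E) q p.
  by apply: reach_sym => u v; apply: linked_sym.
pose base := if d then j else i.
have ra p : m <= p <= i -> reach (linked E) (if d then m else i) p.
  move=> pr; apply: (sub (edges d m a)).
    by move=> z za; rewrite /E in_cons !mem_cat za orbT.
  by apply: IHa; rewrite -/i; case: (d); lia.
have rb p : d + i <= p <= d + i + nodes b -> reach (linked E) base p.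
  move=> pr; apply: (sub (edges (~~ d) (d + i) b)).
    by move=> z za; rewrite /E in_cons !mem_cat za !orbT.
  by apply: IHb; rewrite /base /j; case: (d) pr; lia.
have rc p : j <= p <= j + nodes c -> reach (linked E) (if d then j else j + nodes c) p.
  move=> pr; apply: (sub (edges d j c)).
    by move=> z za; rewrite /E in_cons !mem_cat za !orbT.
  by apply: IHc; case: (d) pr; lia.
have root : linked E (if d then m else i) (if d then j else j + nodes c).
  by left; rewrite /E in_cons; case: (d); rewrite eqxx.
have all p : m <= p <= j + nodes c -> reach (linked E) base p.
  move=> pr; have [pi|pi] := leqP p i.
    have pa : m <= p <= i by lia.
    move: (ra _ pa) root; rewrite /base; case: (d) => // rp rt.
    exact: reach_trans (sym _ _ (reach_one rt)) rp.
  have [jp|jp] := leqP j p.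
    have pc : j <= p <= j + nodes c by lia.
    move: (rc _ pc) root; rewrite /base; case: (d) => // rp rt.
    exact: reach_trans (reach_one rt) rp.
  by apply: rb; case: (d); rewrite /j in jp; lia.
apply: (reach_trans (y := base)); last by apply: all; rewrite /j /i; lia.
by apply: sym; apply: all; rewrite /j /i; lia.
Qed.

(** Connectivity alone: a path from the first point to the last one jumps over
    every gap. *)
Lemma edges_gap d m t g : m <= g < m + nodes t ->
  exists x y, (x, y) \in edges d m t /\ x <= g < y.
Proof.
move=> gr.
have mg : reach (linked (edges d m t)) m (m + nodes t).
  by apply: edges_connected; lia.
have [|p [q [_ pq pg qg]]] := reach_exit (chi := leq^~ g) mg.
  by rewrite negb_eqb; lia.
have mg' : m <= g by lia.
rewrite mg' in pg qg.
case: pq => pq; first by exists p, q; split=> //; lia.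
by case: (edges_range pq); lia.
Qed.

Definition exchange (T : eqType) (s1 s2 : seq T) :=
  exists x y s, perm_eq s1 (x :: s) /\ perm_eq s2 (y :: s).

Lemma exchange_cat (T : eqType) (s s1 s2 s' : seq T) :
  exchange s1 s2 -> exchange (s ++ s1 ++ s') (s ++ s2 ++ s').
Proof.
move=> [x [y [r [p1 p2]]]]; exists x, y, (s ++ r ++ s').
by split; apply/permP => q; [have := permP p1 q | have := permP p2 q];
  rewrite /= !count_cat /=; lia.
Qed.

Lemma nodes_rotation t t' : rotation t t' -> nodes t = nodes t'.
Proof. by elim=> /= *; lia. Qed.

Ltac edge_count :=
  let q := fresh "q" in split; apply/permP => q;
  rewrite /= ?(addnA, addnS, addSn, add0n, add1n) ?count_cat /= ?count_cat /=; lia.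

(** The two roots give two sides of a triangle and the rotated roots give another
    two, with one in common; the five subtrees keep their places. *)
Lemma edges_rotation d m t t' :
  rotation t t' -> exchange (edges d m t) (edges d m t').
Proof.
move=> r; elim: r d m => {t t'}.
- move=> a x y z c [] m.
  + pose u := (m + nodes a + nodes x).+1; pose k := (u + nodes y + nodes z).+1.
    exists (u, k), (m, u), ((m, k) :: edges true m a ++
      edges false (m + nodes a).+1 x ++ edges true u y ++
      edges false (u + nodes y).+1 z ++ edges true k c); rewrite /k /u.
    edge_count.
  + pose i := m + nodes a; pose u := (i + nodes x + nodes y).+1.
    pose e := (u + nodes z + nodes c).+1.
    exists (i, e), (u, e), ((i, u) :: edges false m a ++ edges true i x ++
      edges false (i + nodes x).+1 y ++ edges true u z ++
      edges false (u + nodes z).+1 c); rewrite /e /u /i.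
    edge_count.
- move=> a b x y z [] m.
  + pose j := (m + nodes a + nodes b).+1; pose k := (j + nodes x + nodes y).+1.
    exists (m, j), (m, k), ((j, k) :: edges true m a ++
      edges false (m + nodes a).+1 b ++ edges true j x ++
      edges false (j + nodes x).+1 y ++ edges true k z); rewrite /k /j.
    edge_count.
  + pose i := m + nodes a; pose v := (i + nodes b + nodes x).+1.
    pose e := (v + nodes y + nodes z).+1.
    exists (v, e), (i, v), ((i, e) :: edges false m a ++ edges true i b ++
      edges false (i + nodes b).+1 x ++ edges true v y ++
      edges false (v + nodes y).+1 z); rewrite /e /v /i.
    edge_count.
- move=> a b x y z [] m.
  + pose j := (m + nodes a + nodes b).+1; pose k := (j + nodes x + nodes y).+1.
    exists (j, k), (m, k), ((m, j) :: edges true m a ++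
      edges false (m + nodes a).+1 b ++ edges true j x ++
      edges false (j + nodes x).+1 y ++ edges true k z); rewrite /k /j.
    edge_count.
  + pose i := m + nodes a; pose v := (i + nodes b + nodes x).+1.
    pose e := (v + nodes y + nodes z).+1.
    exists (i, e), (i, v), ((v, e) :: edges false m a ++ edges true i b ++
      edges false (i + nodes b).+1 x ++ edges true v y ++
      edges false (v + nodes y).+1 z); rewrite /e /v /i.
    edge_count.
- move=> a a' b c r IH d m; rewrite /= -(nodes_rotation r).
  exact: (exchange_cat [:: _] _ (IH _ _)).
- move=> a b b' c r IH d m; rewrite /= -(nodes_rotation r).
  exact: (exchange_cat (_ :: edges d m a) _ (IH _ _)).
- move=> a b c c' r IH d m; rewrite /= -(nodes_rotation r).
  set hd := if d then _ else _; set B := edges (~~ d) _ b.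
  have := exchange_cat (hd :: edges d m a ++ B) [::] (IH d (m + nodes a + nodes b).+1).
  by rewrite !cats0 /= -!catA.
Qed.

(** Reversing the order of the points exchanges the two types of trees, so that
    only one type needs to be decoded. *)
Fixpoint mirror t : tree :=
  if t is Node a b c then Node (mirror c) (mirror b) (mirror a) else Leaf.

Lemma mirrorK : involutive mirror.
Proof. by elim=> //= a -> b -> c ->. Qed.

Lemma nodes_mirror t : nodes (mirror t) = nodes t.
Proof. by elim: t => //= a -> b -> c ->; lia. Qed.

Definition reflect_edge w (e : nat * nat) := (w - e.2, w - e.1).

Lemma edges_mirror d u v t w : w = u + v + nodes t ->
  perm_eq (edges (~~ d) v (mirror t)) (map (reflect_edge w) (edges d u t)).
Proof.
elim: t d u v => [|a IHa b IHb c IHc] d u v //= wE.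
rewrite !nodes_mirror !map_cat.
apply/permP => q; rewrite /= !count_cat.
set i := u + nodes a; set j := (i + nodes b).+1.
have -> : count q (map (reflect_edge w) (edges d u a)) =
    count q (edges (~~ d) (v + nodes c + nodes b).+1 (mirror a)).
  by apply/esym/permP/IHa; lia.
have -> : count q (map (reflect_edge w) (edges (~~ d) (d + i) b)) =
    count q (edges (~~ ~~ d) (~~ d + (v + nodes c)) (mirror b)).
  by apply/esym/permP/IHb; rewrite /i; case: (d); lia.
have -> : count q (map (reflect_edge w) (edges d j c)) =
    count q (edges (~~ d) v (mirror c)).
  by apply/esym/permP/IHc; rewrite /j /i; lia.
have -> : (if ~~ d then (v, (v + nodes c + nodes b).+1)
    else (v + nodes c, (v + nodes c + nodes b).+1 + nodes a)) =
    reflect_edge w (if d then (u, j) else (i, j + nodes c)).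
  by case: (d); rewrite /reflect_edge /j /i /=; congr pair; lia.
by congr (_ + _); rewrite addnCA [RHS]addnCA; congr (_ + _); exact: addnC.
Qed.

Lemma mem_edges_mirror d u v t x y : x < y <= u + v + nodes t ->
  ((x, y) \in edges (~~ d) v (mirror t)) =
  ((u + v + nodes t - y, u + v + nodes t - x) \in edges d u t).
Proof.
move=> xy; set w := u + v + nodes t.
rewrite (perm_mem (@edges_mirror d u v t w erefl)).
apply/mapP/idP => [[[p q] /[dup] /edges_range[? ? ?] pq [-> ->]]|h].
  by rewrite !subKn //; lia.
by exists (w - y, w - x); rewrite // /reflect_edge /= !subKn //; lia.
Qed.

(** The root edge leads to the largest neighbour of the first point; the split
    below it is the only gap that no other edge covers, by [edges_gap]. *)
Lemma edges_inj d m t t' : nodes t = nodes t' ->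
  edges d m t =i edges d m t' -> t = t'.
Proof.
have [n] := ubnP (nodes t); elim: n d m t t' => // n IH.
have IHtrue m t t' : nodes t < n.+1 -> nodes t = nodes t' ->
    edges true m t =i edges true m t' -> t = t'.
  case: t t' => [|a b c] [|a' b' c'] //= tn tt' E.
  set k := (m + nodes a + nodes b).+1 in E; set k' := (m + nodes a' + nodes b').+1 in E.
  have top (a1 b1 c1 : tree) y :
      (m, y) \in edges true m (Node a1 b1 c1) -> y <= (m + nodes a1 + nodes b1).+1.
    rewrite /= in_cons !mem_cat => /or4P[/eqP[->]//|||] /edges_range[]; lia.
  have kk' : k = k'.
    have h1 : k <= k' by apply: (top a' b' c'); rewrite /= -E in_cons eqxx.
    have h2 : k' <= k by apply: (top a b c); rewrite /= E in_cons eqxx.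
    lia.
  have no_gap (a1 b1 c1 a2 b2 c2 : tree) :
      edges true m (Node a1 b1 c1) =i edges true m (Node a2 b2 c2) ->
      nodes a1 + nodes b1 = nodes a2 + nodes b2 -> nodes a1 < nodes a2 -> False.
    move=> E' ab lt12.
    have [|x [y [xy xgy]]] := @edges_gap false (m + nodes a1).+1 b1 (m + nodes a2).
      by lia.
    have := E' (x, y); rewrite /= !in_cons !mem_cat xy !orbT => /esym.
    have [? ? ?] := edges_range xy.
    case/or4P => [/eqP[]|||]; [lia|..] => /edges_range[]; lia.
  have aa' : nodes a = nodes a'.
    have ab : nodes a + nodes b = nodes a' + nodes b' by lia.
    case: (ltngtP (nodes a) (nodes a')) => // lt12.
      by case: (no_gap a b c a' b' c').
    by case: (no_gap a' b' c' a b c) => // z; rewrite E.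
  have bb' : nodes b = nodes b' by lia.
  have cc' : nodes c = nodes c' by lia.
  have sub (a1 b1 c1 a2 b2 c2 : tree) :
      edges true m (Node a1 b1 c1) =i edges true m (Node a2 b2 c2) ->
      nodes a1 = nodes a2 -> nodes b1 = nodes b2 ->
      [/\ {subset edges true m a1 <= edges true m a2},
        {subset edges false (m + nodes a1).+1 b1 <= edges false (m + nodes a1).+1 b2} &
        {subset edges true (m + nodes a1 + nodes b1).+1 c1 <=
                edges true (m + nodes a1 + nodes b1).+1 c2}].
    move=> E' e1 e2; split=> -[x y] xy; have := E' (x, y);
      rewrite /= !in_cons !mem_cat xy ?orbT -e1 -e2 => /esym;
      have [? ? ?] := edges_range xy;
      case/or4P => [/eqP[]|h|h|h] //; try lia; by have := edges_range h; case; lia.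
  have [sa sb sc] := sub _ _ _ _ _ _ E aa' bb'.
  have [] := sub _ _ _ _ _ _ (fun z => esym (E z)) (esym aa') (esym bb').
  rewrite -aa' -bb' => sa' sb' sc'.
  by congr Node; [apply: (IH true m)|apply: (IH false (m + nodes a).+1)|
    apply: (IH true (m + nodes a + nodes b).+1)] => //; try lia;
    move=> z; apply/idP/idP; auto.
case=> m t t' tn tt' E; first exact: IHtrue E.
rewrite -[t]mirrorK -[t']mirrorK; congr mirror.
apply: (IHtrue m); rewrite ?nodes_mirror // => -[x y].
have [xy|nxy] := boolP (x < y <= m + m + nodes t).
  have xy' : x < y <= m + m + nodes t' by rewrite -tt'.
  by rewrite !(@mem_edges_mirror false m m) // E tt'.
by apply/idP/idP => /edges_range[]; rewrite !nodes_mirror; lia.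
Qed.

(** * Decoding non-crossing spanning trees *)
Section Decode.
Implicit Type e : rel nat.

Definition inside lo hi e p q : Prop := [/\ e p q, lo <= p <= hi & lo <= q <= hi].

Definition without (e : nat -> nat -> Prop) x y p q : Prop :=
  [/\ e p q, ~ (p = x /\ q = y) & ~ (p = y /\ q = x)].

(** Acyclicity is expressed by saying that every edge is a bridge, which passes to
    subintervals and to mirror images. *)
Definition planar_forest e : Prop :=
  [/\ symmetric e,
      forall a b c d, a < b -> b < c -> c < d -> e a c -> e b d -> False
    & forall x y, x < y -> e x y -> ~ reach (without e x y) x y].

Lemma inside_sym lo hi e p q :
  symmetric e -> inside lo hi e p q -> inside lo hi e q p.
Proof. by move=> es [pq ? ?]; split; rewrite // es. Qed.

Lemma planar_forest_reflect e w : planar_forest e ->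
  planar_forest (fun x y => [&& x <= w, y <= w & e (w - x) (w - y)]).
Proof.
case=> es nc br; split.
- by move=> x y; rewrite es andbCA.
- move=> a b c d ab bc cd /and3P[_ _ ac] /and3P[_ dw bd].
  by apply: (nc (w - d) (w - c) (w - b) (w - a)); rewrite 1?es //; lia.
move=> x y xy /and3P[xw yw exy] r.
apply: (br (w - y) (w - x)); [lia|by rewrite es|].
apply: reach_sym.
  by move=> p q [pq n1 n2]; split; rewrite 1?es //; move=> [? ?]; [apply: n2|apply: n1].
apply: reach_image r => p q [/and3P[pw qw pq] n1 n2]; right; split=> //.
  by move=> [? ?]; apply: n2; split; lia.
by move=> [? ?]; apply: n1; split; lia.
Qed.

(** Let k be the largest neighbour of u.  No edge jumps over k, so the parts on
    both sides of k are connected: move paths into them by [maxn^~ k] and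
    [minn^~ k].  Without the edge uk, the points of [u, k] fall into those
    connected to u and those connected to k.  If y were on the side of k and x > y
    on the side of u, an edge of a path from u to x would jump over y, and the path
    from k to y would have to cross it; so the first part is an interval
    [u, j]. *)
Lemma decode_node e u v k : planar_forest e -> u < k <= v -> e u k ->
  (forall k', k < k' <= v -> ~~ e u k') ->
  (forall x, u <= x <= v -> reach (inside u v e) u x) ->
  exists j, [/\ u <= j < k,
    forall x, u <= x <= j -> reach (inside u j e) u x,
    forall x, j < x <= k -> reach (inside j.+1 k e) k x,
    forall x, k <= x <= v -> reach (inside k v e) k x &
    forall x y, u <= x -> x < y -> y <= v -> e x y ->
      [|| y <= j, (x == u) && (y == k), (j < x) && (y <= k) | k <= x]].
Proof.
move=> [es nc br] ukv euk kmax conn.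
have cross_k x y : x < k -> k < y -> u <= x -> y <= v -> e x y -> False.
  move=> xk ky ux yv exy; have [xu|xu] := eqVneq x u.
    by have := kmax y; rewrite -xu exy ky yv => /(_ isT).
  by apply: (nc u x k y) => //; lia.
have conn_hi x : k <= x <= v -> reach (inside k v e) k x.
  move=> xr; have -> : x = maxn x k by lia.
  have -> : k = maxn u k by lia.
  have -> : maxn x (maxn u k) = maxn x k by lia.
  apply: (@reach_image _ _ (inside u v e) _ (maxn^~ k)); last by apply: conn; lia.
  move=> p q [pq pr qr].
  have [pk|pk] := leqP k p; have [qk|qk] := leqP k q.
  - right; split; [done|lia|lia].
  - have [pk'|pk'] := eqVneq p k; first by left; lia.
    by case: (cross_k q p); rewrite 1?es //; lia.
  - have [qk'|qk'] := eqVneq q k; first by left; lia.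
    by case: (cross_k p q) => //; lia.
  - by left; lia.
have conn_lo x : u <= x <= k -> reach (inside u k e) u x.
  move=> xr; have -> : x = minn x k by lia.
  have {2}-> : u = minn u k by lia.
  apply: (@reach_image _ _ (inside u v e) _ (minn^~ k)); last by apply: conn; lia.
  move=> p q [pq pr qr].
  have [pk|pk] := leqP p k; have [qk|qk] := leqP q k.
  - right; split; [done|lia|lia].
  - have [pk'|pk'] := eqVneq p k; first by left; lia.
    by case: (cross_k p q) => //; lia.
  - have [qk'|qk'] := eqVneq q k; first by left; lia.
    by case: (cross_k q p); rewrite 1?es //; lia.
  - by left; lia.
pose e' := without (inside u k e) u k.
have e'_sym p q : e' p q -> e' q p.
  move=> [/(inside_sym es) qp n1 n2]; split=> //.
    by move=> [? ?]; apply: n2.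
  by move=> [? ?]; apply: n1.
have A_or_B x : u <= x <= k -> reach e' u x \/ reach e' k x.
  move=> xr; have := conn_lo x xr; elim=> [|p q _ IH pq].
    by left; exact: reach_refl.
  have [[_ ->]|n1] := pselect (p = u /\ q = k); first by right; exact: reach_refl.
  have [[_ ->]|n2] := pselect (p = k /\ q = u); first by left; exact: reach_refl.
  have epq : e' p q by split.
  by case: IH => r; [left|right]; apply: reach_step r epq.
have A_B x : reach e' u x -> reach e' k x -> False.
  move=> ux kx; apply: (br u k) => //; first by lia.
  have : reach e' u k by apply: reach_trans ux (reach_sym _ kx).
  by apply: reach_sub => p q [[pq _ _] n1 n2]; split.
have range x z : (z = u \/ z = k) -> reach e' z x -> u <= x <= k.
  by move=> zuk; elim=> [|p q _ _ [[]]//]; case: zuk => ->; lia.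
pose P x := `[< reach e' u x >].
have exP : exists x, P x by exists u; apply/asboolP/reach_refl.
have bP x : P x -> x <= k by move=> /asboolP/range; move=> /(_ (or_introl erefl)); lia.
have [j /asboolP Aj jmax] := ex_maxnP exP bP.
have uj : u <= j <= k by apply: (range j u) Aj; left.
have jk : j < k.
  rewrite ltn_neqAle; apply/andP; split; last by lia.
  by apply/eqP => jk; apply: (A_B k); [rewrite -jk | exact: reach_refl].
have below x : u <= x <= j -> reach e' u x.
  move=> xr; have [//|Bx] : reach e' u x \/ reach e' k x by apply: A_or_B; lia.
  have [<-//|xj] := eqVneq j x.
  have [ux|nux] := eqVneq u x; first by rewrite ux; exact: reach_refl.
  have [|p [q [up pq px qx]]] := reach_exit (chi := leq^~ x) Aj.
    by rewrite negb_eqb; lia.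
  have ux' : u <= x by lia.
  rewrite ux' in px qx.
  have uq := reach_step up pq.
  have px' : p != x by apply/eqP => E; apply: (A_B x) Bx; rewrite -E.
  have [qr pr] : u <= q <= k /\ u <= p <= k.
    by split; [apply: (range q u) uq|apply: (range p u) up]; left.
  have qk : q != k by apply/eqP => E; apply: (A_B k); [rewrite -E|exact: reach_refl].
  have [|p' [q' [kp' pq' p'r q'r]]] := reach_exit (chi := fun z => p < z < q) Bx.
    by rewrite negb_eqb; lia.
  have kq' := reach_step kp' pq'.
  have [n1 n2] : p' != p /\ p' != q.
    by split; apply/eqP => E; apply: (A_B p') kp'; rewrite E.
  case: pq pq' => -[epq _ _] _ _ [[epq' _ _] _ _].
  have [p'p|pp'] := ltnP p' p.
    by case: (nc p' p q' q) => //; lia.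
  by case: (nc p q' q p') => //; rewrite 1?es //; lia.
exists j; split=> //; first lia.
- move=> x /below; elim=> [|p q up IH epq]; first exact: reach_refl.
  apply: reach_step IH _; case: (epq) => -[pq pr qr] _ _.
  have pj : p <= j by apply: jmax; apply/asboolP.
  have qj : q <= j by apply: jmax; apply/asboolP/(reach_step up).
  by split=> //; lia.
- move=> x xr.
  have : reach e' k x.
    have [|ux|//] := A_or_B x; first lia.
    by have := jmax x; rewrite /P; move/asboolP: ux => -> /(_ isT); lia.
  elim=> [|p q kp IH epq]; first exact: reach_refl.
  apply: reach_step IH _; case: (epq) => -[pq pr qr] _ _.
  have above z : reach e' k z -> u <= z <= k -> j < z.
    by move=> kz zr; rewrite ltnNge; apply/negP => zj; apply: (A_B z) kz; apply: below; lia.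
  by split=> //; [have := above p kp pr|have := above q (reach_step kp epq) qr]; lia.
move=> x y ux xy yv exy.
have [//|yj] := leqP y j; have [//|xk] := leqP k x; rewrite ?orbT //=.
have yk : y <= k by rewrite leqNgt; apply/negP => ky; apply: (cross_k x y).
rewrite yk andbT orbF; case: (leqP x j) => [xj|]; rewrite ?orbT // orbF.
have [[-> ->]|n1] := pselect (x = u /\ y = k); first by rewrite !eqxx.
have : reach e' u y.
  apply: (reach_step (below x _)); first by lia.
  by split=> //; [split=> //; lia | lia].
by move=> /asboolP/jmax; lia.
Qed.

(** [decode_node] cuts the interval into three parts, which are decoded
    recursively, the middle one through its mirror image. *)
Lemma edges_decode e u s : planar_forest e ->
  (forall x, u <= x <= u + s -> reach (inside u (u + s) e) u x) ->
  exists2 t, nodes t = s & forall x y, u <= x -> x < y -> y <= u + s ->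
    e x y = ((x, y) \in edges true u t).
Proof.
have [n] := ubnP s; elim: n e u s => // n IH e u s sn F conn.
have [-> |s0] := posnP s.
  by exists Leaf => // x y; lia.
pose v := u + s.
have [es nc br] := F.
have exP : exists k, [&& u < k, k <= v & e u k].
  have uv : reach (inside u v e) u v by apply: conn; lia.
  have [|p [q [_ [pq pr qr] pu qu]]] := reach_exit (chi := pred1 u) uv.
    by rewrite /= eqxx (_ : (v == u) = false) //; lia.
  move: pu qu; rewrite /= eqxx eqb_id => /eqP pu qu; exists q.
  by rewrite -{2}pu pq andbT; move: qu; case: eqP => // qu _; lia.
have bP k : [&& u < k, k <= v & e u k] -> k <= v by case/and3P.
have [k /and3P[uk kv euk] kmax] := ex_maxnP exP bP.
have [|k' kk'|j [ujk ca cb cc sep]] := @decode_node e u v k F _ euk _ conn.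
- lia.
- by apply/negP => euk'; have := kmax k'; rewrite euk'; lia.
have [|x xr|ta na Ea] := IH e u (j - u) _ F; first lia.
  by rewrite subnKC; [apply: ca; lia|lia].
have [|x xr|tc nc' Ec] := IH e k (v - k) _ F; first lia.
  by rewrite subnKC; [apply: cc; lia|lia].
pose w := j.+1 + k.
have [|x xr|tb nb Eb] := IH _ j.+1 (k - j.+1) _ (planar_forest_reflect w F); first lia.
  rewrite subnKC; last lia.
  have -> : j.+1 = w - k by lia.
  have -> : x = w - (w - x) by lia.
  apply: (@reach_image _ _ (inside j.+1 k e) _ (subn w)); last by apply: cb; lia.
  move=> p q [pq pr qr]; right; split; try lia.
  by rewrite !leq_subr /= !subKn //; lia.
exists (Node ta (mirror tb) tc); first by rewrite /= nodes_mirror; lia.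
have Eb' x y : j < x -> x < y -> y <= k ->
    e x y = ((x, y) \in edges false j.+1 (mirror tb)).
  move=> jx xy yk; have xyw : x < y <= j.+1 + j.+1 + nodes tb by lia.
  rewrite (@mem_edges_mirror true j.+1 j.+1) //.
  have -> : j.+1 + j.+1 + nodes tb = w by lia.
  rewrite -Eb; try lia.
  by rewrite !leq_subr !subKn ?[e y x]es //; lia.
move=> x y ux xy yv.
rewrite /= nodes_mirror na nb.
have -> : (u + (j - u) + (k - j.+1)).+1 = k by lia.
have -> : 1 + (u + (j - u)) = j.+1 by lia.
rewrite in_cons !mem_cat xpair_eqE.
have ra : (x, y) \in edges true u ta -> y <= j by move=> /edges_range[]; lia.
have rb : (x, y) \in edges false j.+1 (mirror tb) -> j < x /\ y <= k.
  by move=> /edges_range[]; rewrite nodes_mirror; lia.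
have rc : (x, y) \in edges true k tc -> k <= x by move=> /edges_range[].
apply/idP/idP => [exy|].
  case/or4P: (sep x y ux xy yv exy) => [yj|->//|/andP[jx yk]|kx].
  - by rewrite -Ea ?exy ?orbT //; lia.
  - by rewrite -Eb' ?exy ?orbT //; lia.
  - by rewrite -Ec ?exy ?orbT //; lia.
case/or4P => [/andP[/eqP-> /eqP->]//|h|h|h].
- by rewrite Ea //; have := ra h; lia.
- by rewrite Eb' //; have := rb h; lia.
- by rewrite Ec //; have := rc h; lia.
Qed.
End Decode.
End Edges.

(** * Points in convex position and their cyclic order *)
Section ConvexPosition.
Variables (R : realType) (n : nat) (p : 'I_n.+1 -> 'rV[R]_2).
Hypothesis convex : convex_position p.
Implicit Types i j k l : 'I_n.+1.

Definition turn (a b c : 'rV[R]_2) : R :=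
  (b 0 0 - a 0 0) * (c 0 1 - a 0 1) - (b 0 1 - a 0 1) * (c 0 0 - a 0 0).

Definition orient i j k : R := turn (p i) (p j) (p k).

Lemma plane_eq (a b : 'rV[R]_2) : a 0 0 = b 0 0 -> a 0 1 = b 0 1 -> a = b.
Proof.
move=> e0 e1; apply/rowP => i; case: (@unliftP _ ord0 i) => [j ->|->]; last exact: e0.
by rewrite (ord1 j); have -> : lift ord0 0 = 1 :> 'I_2 by apply/val_inj.
Qed.

Lemma hull_comb (A : {set 'I_n.+1}) i j k (a b c : R) :
  i \in A -> j \in A -> k \in A -> 0 <= a -> 0 <= b -> 0 <= c -> a + b + c = 1 ->
  hull p A (a *: p i + b *: p j + c *: p k).
Proof.
move=> iA jA kA a0 b0 c0 abc.
exists (fun l => a * (l == i)%:R + b * (l == j)%:R + c * (l == k)%:R).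
have pick (r : R) l : l \in A -> \sum_(i in A) (r * (i == l)%:R) *: p i = r *: p l.
  move=> lA; rewrite (bigD1 l) //= eqxx mulr1 big1 ?addr0 // => m /andP[_ /negbTE ->].
  by rewrite mulr0 scale0r.
have pick1 (r : R) l : l \in A -> \sum_(i in A) r * (i == l)%:R = r.
  move=> lA; rewrite (bigD1 l) //= eqxx mulr1 big1 ?addr0 // => m /andP[_ /negbTE ->].
  by rewrite mulr0.
split.
- by move=> l; rewrite !addr_ge0 ?mulr_ge0.
- rewrite !big_split /= -[RHS]abc.
  by rewrite !pick1.
- under [RHS]eq_bigr => l _ do rewrite !scalerDl.
  by rewrite !big_split /= !pick.
Qed.

Lemma convex_comb i j k l (a b c : R) : i != l -> j != l -> k != l ->
  0 <= a -> 0 <= b -> 0 <= c -> 0 < a + b + c ->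
  (a + b + c) *: p l = a *: p i + b *: p j + c *: p k -> False.
Proof.
move=> il jl kl a0 b0 c0 s0 e; apply: (convex (i := l)).
have -> : p l = (a / (a + b + c)) *: p i + (b / (a + b + c)) *: p j +
    (c / (a + b + c)) *: p k.
  have sn : a + b + c != 0 by rewrite gt_eqF.
  rewrite ![_ / _]mulrC -!scalerA -!scalerDr -e scalerA mulVf //.
  by rewrite scale1r.
have s00 := ltW s0.
by apply: hull_comb; rewrite ?inE ?divr_ge0 // -!mulrDl divff // gt_eqF.
Qed.

Lemma orientC i j k : orient i j k = orient j k i.
Proof. by rewrite /orient /turn; ring. Qed.

Lemma orientN i j k : orient i j k = - orient i k j.
Proof. by rewrite /orient /turn; ring. Qed.

(** Of three collinear points one lies between the other two; which one is read
    off from the coordinate s / d of [p k] on the line with origin [p i] and unit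
    point [p j]. *)
Lemma orient_neq0 i j k : i != j -> j != k -> i != k -> orient i j k != 0.
Proof.
move=> ij jk ik; apply/eqP; rewrite /orient /turn => o0.
pose a0 := p j 0 0 - p i 0 0; pose a1 := p j 0 1 - p i 0 1.
pose b0 := p k 0 0 - p i 0 0; pose b1 := p k 0 1 - p i 0 1.
have {}o0 : a0 * b1 - a1 * b0 = 0 by [].
have pk0 : p k 0 0 = b0 + p i 0 0 by rewrite /b0; ring.
have pk1 : p k 0 1 = b1 + p i 0 1 by rewrite /b1; ring.
have pj0 : p j 0 0 = a0 + p i 0 0 by rewrite /a0; ring.
have pj1 : p j 0 1 = a1 + p i 0 1 by rewrite /a1; ring.
pose d := a0 ^+ 2 + a1 ^+ 2; pose s := a0 * b0 + a1 * b1.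
have d0 : 0 <= d by rewrite addr_ge0 ?sqr_ge0.
have [dz|dn] := eqVneq d 0.
  have a00 : a0 = 0 by apply/eqP; rewrite -sqrf_eq0; have := sqr_ge0 a0; have := sqr_ge0 a1; move: dz; rewrite /d => *; apply/eqP; lra.
  have a10 : a1 = 0 by apply/eqP; rewrite -sqrf_eq0; have := sqr_ge0 a0; have := sqr_ge0 a1; move: dz; rewrite /d => *; apply/eqP; lra.
  apply: (@convex_comb i i i j 1 0 0) => //; rewrite ?addr0 //.
  by apply: plane_eq; rewrite !mxE ?pj0 ?pj1 ?a00 ?a10; ring.
have dp : 0 < d by rewrite lt_def dn.
have db0 : d * b0 = s * a0.
  have -> : d * b0 = s * a0 - a1 * (a0 * b1 - a1 * b0) by rewrite /d /s; ring.
  by rewrite o0 mulr0 subr0.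
have db1 : d * b1 = s * a1.
  have -> : d * b1 = s * a1 + a0 * (a0 * b1 - a1 * b0) by rewrite /d /s; ring.
  by rewrite o0 mulr0 addr0.
have [sn|sp] := ltP s 0.
  apply: (@convex_comb j k k i (- s) d 0) => //; rewrite 1?eq_sym ?oppr_ge0 ?ltW //.
    by rewrite addr0 addr_gt0 // oppr_gt0.
  by apply: plane_eq; rewrite !mxE ?pk0 ?pk1 ?pj0 ?pj1; [ring: db0|ring: db1].
have [sd|ds] := leP s d.
  apply: (@convex_comb i j j k (d - s) s 0) => //; rewrite ?subr_ge0 //.
    by rewrite subrK addr0.
  by apply: plane_eq; rewrite !mxE ?pk0 ?pk1 ?pj0 ?pj1; [ring: db0|ring: db1].
apply: (@convex_comb k i i j d (s - d) 0) => //; rewrite 1?eq_sym ?subr_ge0 ?ltW //.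
  by rewrite addr0 addrC subrK; lra.
by apply: plane_eq; rewrite !mxE ?pk0 ?pk1 ?pj0 ?pj1; [ring: db0|ring: db1].
Qed.

(** The order in which the other points are seen from the point of index 0. *)
Definition before i j := (j != ord0) && ((i == ord0) || (0 < orient ord0 i j)).

Lemma orient_ii i j : orient i j j = 0.
Proof. by rewrite /orient /turn; ring. Qed.

Lemma before_irr i : before i i = false.
Proof. by rewrite /before orient_ii ltxx orbF andNb. Qed.

Lemma before_total i j : i != j -> before i j || before j i.
Proof.
move=> ij; rewrite /before.
have [i0|i0] := eqVneq i ord0; first by rewrite -i0 [j == i]eq_sym ij.
have [->|j0] /= := eqVneq j ord0; first by [].
rewrite (orientN _ j i) oppr_gt0 -neq_lt eq_sym.
by apply: orient_neq0 => //; rewrite eq_sym.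
Qed.

(** A cyclic triple would surround the point of index 0. *)
Lemma before_trans : transitive before.
Proof.
move=> j i k; rewrite /before => /andP[j0 ij] /andP[k0]; rewrite (negbTE j0) k0 /=.
case: eqVneq ij => //= i0 ij jk.
have ik : i != k by apply/eqP => e; move: ij jk; rewrite e orientN; lra.
have o : orient ord0 i k != 0 by apply: orient_neq0; rewrite // eq_sym.
rewrite lt_def o leNgt; apply/negP => ki.
apply: (@convex_comb i j k ord0 (orient ord0 j k) (- orient ord0 i k) (orient ord0 i j));
  rewrite ?oppr_ge0 ?ltW //.
  by move: ij jk ki; lra.
by apply: plane_eq; rewrite !mxE /orient /turn; ring.
Qed.

(** Otherwise [p j] would lie in the triangle on [p ord0], [p i] and [p k]. *)
Lemma before_orient i j k : before i j -> before j k -> 0 < orient i j k.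
Proof.
move=> ij jk; have := before_trans ij jk; move: ij jk; rewrite /before.
move=> /andP[j0 +] /andP[k0 +] /andP[_ +]; rewrite (negbTE j0) /=.
case: eqVneq => [-> //|i0 /= ij jk ik].
rewrite ltNge; apply/negP => ijk.
have ij' : i != j by apply/eqP => e; move: ij; rewrite e orient_ii ltxx.
have kj' : k != j by apply/eqP => e; move: jk; rewrite e orient_ii ltxx.
apply: (@convex_comb ord0 i k j (- orient i j k) (orient ord0 j k) (orient ord0 i j));
  rewrite ?oppr_ge0 // 1?eq_sym // ?(ltW ij) ?(ltW jk) //.
  have -> : - orient i j k + orient ord0 j k + orient ord0 i j = orient ord0 i k.
    by rewrite /orient /turn; ring.
  by [].
by apply: plane_eq; rewrite !mxE /orient /turn; ring.
Qed.

Lemma cyclic_order : exists2 q : 'I_n.+1 -> 'I_n.+1, bijective q &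
  forall i j k, (i < j)%N -> (j < k)%N -> 0 < orient (q i) (q j) (q k).
Proof.
have rank_lt i : (#|[set j | before j i]| < n.+1)%N.
  suff /proper_card : [set j | before j i] \proper [set: 'I_n.+1].
    by rewrite cardsT card_ord.
  rewrite properT.
  by apply/eqP => /setP/(_ i); rewrite !inE before_irr.
pose rank i := Ordinal (rank_lt i).
have rank_mono i j : before i j -> (rank i < rank j)%N.
  move=> ij; apply/proper_card/properP; split.
    by apply/fintype.subsetP => k; rewrite !inE => /before_trans; apply.
  by exists i; rewrite inE ?before_irr.
have rank_inj : injective rank.
  move=> i j rij; apply/eqP/negPn/negP => /before_total/orP[] /rank_mono.
    by rewrite rij ltnn.
  by rewrite rij ltnn.
have [q rankK qK] := injF_bij rank_inj.
exists q; first by exists rank.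
have q_mono i j : (i < j)%N -> before (q i) (q j).
  move=> ij; have /before_total/orP[//|/rank_mono] : q i != q j.
    by rewrite (can_eq qK) -val_eqE /= ltn_eqF.
  by rewrite !qK ltnNge ltnW.
by move=> i j k /q_mono ij /q_mono jk; apply: before_orient.
Qed.

Lemma hull2P i j v : i != j -> hull p [set i; j] v ->
  exists s t : R, [/\ 0 <= s, 0 <= t, s + t = 1 & v = s *: p i + t *: p j].
Proof.
move=> ij [w [w0 w1 ->]]; exists (w i), (w j); split=> //.
  by rewrite -w1 big_setU1 ?big_set1 // inE.
by rewrite big_setU1 ?big_set1 // inE.
Qed.

Lemma hull2_comb i j (s t : R) : 0 <= s -> 0 <= t -> s + t = 1 ->
  hull p [set i; j] (s *: p i + t *: p j).
Proof.
move=> s0 t0 st; rewrite -[_ + _]addr0 -(scale0r (p i)).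
by apply: hull_comb; rewrite ?addr0 // !inE eqxx ?orbT.
Qed.

(** The intersection of the diagonals, with barycentric weights given by areas. *)
Lemma segments_cross i j k l :
  0 < orient i j k -> 0 < orient j k l -> 0 < orient i k l -> 0 < orient i j l ->
  exists v, hull p [set i; k] v /\ hull p [set j; l] v.
Proof.
move=> ijk jkl ikl ijl.
have D0 : 0 < orient i j l + orient j k l by rewrite addr_gt0.
have D0' : orient i k l + orient i j k = orient i j l + orient j k l.
  by rewrite /orient /turn; ring.
pose D := orient i j l + orient j k l.
exists ((orient j k l / D) *: p i + (orient i j l / D) *: p k); split.
  apply: hull2_comb; rewrite ?divr_ge0 ?ltW //.
  by rewrite -mulrDl addrC divff // gt_eqF.
have -> : (orient j k l / D) *: p i + (orient i j l / D) *: p k =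
    (orient i k l / D) *: p j + (orient i j k / D) *: p l.
  have Dn : D != 0 by rewrite gt_eqF.
  rewrite ![_ / D]mulrC -!scalerA -!scalerDr; congr (_ *: _).
  by apply: plane_eq; rewrite !mxE /orient /turn; ring.
apply: hull2_comb; rewrite ?divr_ge0 ?ltW //.
by rewrite -mulrDl D0' divff // gt_eqF.
Qed.

Lemma segments_apart i j k l v : i != j -> k != l ->
  0 < orient i j k * orient i j l ->
  hull p [set i; j] v -> hull p [set k; l] v -> False.
Proof.
move=> ij kl same /(hull2P ij)[s [t [_ _ st vij]]] /(hull2P kl)[s' [t' [s0 t0 st' vkl]]].
have o0 : turn (p i) (p j) v = 0.
  have sE : s = 1 - t by rewrite -st addrK.
  by rewrite vij sE /turn !mxE; ring.
have : s' * orient i j k + t' * orient i j l = 0.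
  rewrite -[RHS]o0 vkl /orient /turn !mxE.
  have -> : t' = 1 - s' by rewrite -st'; ring.
  by ring.
move: same s0 t0 st'; set a := orient i j k; set b := orient i j l => ab s0 t0 st' z.
have : 0 < a ^+ 2 * s' + a * b * t'.
  have a2 : 0 < a ^+ 2 by rewrite lt_def sqr_ge0 sqrf_eq0 andbT; apply/eqP => a0; rewrite a0 mul0r ltxx in ab.
  have [e|sn] := eqVneq s' 0; first by rewrite -[t'](add0r t') -e st' mulr1 e mulr0 add0r.
  have s'p : 0 < s' by rewrite lt_def sn.
  by apply: ltr_pwDl; [exact: mulr_gt0 | apply: mulr_ge0 => //; exact: ltW].
have -> : a ^+ 2 * s' + a * b * t' = a * (s' * a + t' * b) by ring.
by rewrite z mulr0 ltxx.
Qed.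

Lemma segments_share i j k v : orient i j k != 0 -> i != j -> i != k ->
  hull p [set i; j] v -> hull p [set i; k] v -> v = p i.
Proof.
move=> o ij ik /(hull2P ij)[s [t [_ _ st vij]]] /(hull2P ik)[s' [t' [_ _ st' vik]]].
have t0 : t * orient i j k = 0.
  have e0 : v 0 0 = s * p i 0 0 + t * p j 0 0 by rewrite vij !mxE.
  have e1 : v 0 1 = s * p i 0 1 + t * p j 0 1 by rewrite vij !mxE.
  have -> : t * orient i j k = turn (p i) v (p k).
    rewrite /turn e0 e1; have -> : s = 1 - t by rewrite -st; ring.
    by rewrite /orient /turn; ring.
  have -> : v = (1 - t') *: p i + t' *: p k by rewrite vik -st' addrK.
  by rewrite /turn !mxE; ring.
have tz : t = 0 by move/eqP: t0; rewrite mulf_eq0 (negbTE o) orbF => /eqP.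
by rewrite vij -[s](addrK t) st tz subr0 scale1r scale0r addr0.
Qed.

Variable q : 'I_n.+1 -> 'I_n.+1.
Hypothesis q_bij : bijective q.
Hypothesis q_turn :
  forall i j k, (i < j)%N -> (j < k)%N -> 0 < orient (q i) (q j) (q k).

Definition uncrossed (T : {set {set 'I_n.+1}}) := forall i j k l,
  (i < j)%N -> (j < k)%N -> (k < l)%N ->
  [set q i; q k] \in T -> [set q j; q l] \in T -> False.

Lemma edge_ends (e : {set 'I_n.+1}) : #|e| = 2%N ->
  exists i j, (i < j)%N /\ e = [set q i; q j].
Proof.
move=> /eqP/cards2P[a [b [ab ->]]]; have [q' q'K qK] := q_bij.
have [lab|lba|/val_inj E] := ltngtP (q' a) (q' b).
- by exists (q' a), (q' b); rewrite !qK.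
- by exists (q' b), (q' a); rewrite !qK finset.setUC.
- by move: ab; rewrite -(qK a) -(qK b) E eqxx.
Qed.

Lemma q_neq i j : (i < j)%N -> q i != q j.
Proof. by move=> ij; rewrite (bij_eq q_bij) -val_eqE /= ltn_eqF. Qed.

Lemma non_crossingP (T : {set {set 'I_n.+1}}) :
  (forall e, e \in T -> #|e| = 2%N) -> non_crossing p T <-> uncrossed T.
Proof.
move=> T2; split=> [nc i j k l ij jk kl ik jl|un].
  have [||||v [vik vjl]] := @segments_cross (q i) (q j) (q k) (q l);
    try by apply: q_turn => //; lia.
  have ne : [set q i; q k] != [set q j; q l].
    apply/eqP => /setP/(_ (q i)); rewrite !inE eqxx /= => /esym.
    by rewrite !(bij_eq q_bij) -!val_eqE /=; lia.
  have [m + _] := nc _ _ ik jl ne v vik vjl.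
  rewrite !inE => /andP[/orP[]/eqP->];
    by rewrite !(bij_eq q_bij) -!val_eqE /=; lia.
move=> e f eT fT ef v ve vf.
have [i [j [ij eE]]] := edge_ends (T2 _ eT).
have [k [l [kl fE]]] := edge_ends (T2 _ fT).
move: eT fT ef ve vf; rewrite eE fE => {e f eE fE} eT fT ef ve vf.
have share (a b c : 'I_n.+1) : a != b -> b != c -> a != c ->
    hull p [set q a; q b] v -> hull p [set q a; q c] v -> v = p (q a).
  move=> ab bc ac; apply: segments_share; rewrite ?(bij_eq q_bij) //.
  by apply: orient_neq0; rewrite (bij_eq q_bij).
have ord_neq (a b : 'I_n.+1) : val a != val b -> a != b by [].
have [ik|nik] := eqVneq i k.
  subst k; exists (q i); first by rewrite !inE eqxx.
  apply: (share i j l) => //; try (by apply: ord_neq => /=; lia).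
  by apply: contraNneq ef => ->.
have [jl|njl] := eqVneq j l.
  subst l; exists (q j); first by rewrite !inE eqxx !orbT.
  by apply: (share j i k) => //; try (by apply: ord_neq => /=; lia);
    rewrite finset.setUC.
have [il|nil] := eqVneq i l.
  subst l; exists (q i); first by rewrite !inE eqxx !orbT.
  by apply: (share i j k) => //; try (by apply: ord_neq => /=; lia);
    rewrite finset.setUC.
have [jk|njk] := eqVneq j k.
  subst k; exists (q j); first by rewrite !inE eqxx !orbT.
  by apply: (share j i l) => //; try (by apply: ord_neq => /=; lia);
    rewrite finset.setUC.
exfalso; move: nik njl nil njk; rewrite -!val_eqE /= => nik njl nil njk.
have pos (a b c : 'I_n.+1) : (a < b)%N -> (b < c)%N -> 0 < orient (q a) (q b) (q c) by exact: q_turn.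
have apart := @segments_apart (q i) (q j) (q k) (q l) v (q_neq ij) (q_neq kl).
have pp (x y : R) : 0 < x -> 0 < y -> 0 < x * y by exact: mulr_gt0.
have nn (x y : R) : 0 < x -> 0 < y -> 0 < (- x) * (- y) by rewrite mulrNN; exact: mulr_gt0.
have [ki|ik] := ltnP k i.
  have [li|il] := ltnP l i.
    apply: apart ve vf; apply: pp; rewrite -orientC; apply: pos => //; lia.
  have [lj|jl] := ltnP l j.
    by apply: (un k i l j) => //; lia.
  apply: apart ve vf; apply: pp; first by rewrite -orientC; apply: pos => //; lia.
  by apply: pos => //; lia.
have [jk|kj] := ltnP j k.
  by apply: apart ve vf; apply: pp; apply: pos => //; lia.
have [lj|jl] := ltnP l j.
  apply: apart ve vf; rewrite orientN [orient _ _ (q l)]orientN.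
  by apply: nn; apply: pos => //; lia.
by apply: (un i k j l) => //; lia.
Qed.

End ConvexPosition.

(** * Ternary trees as non-crossing spanning trees of the points *)
Section TreesOfPoints.
Variables (R : realType) (n : nat) (p : 'I_n.+1 -> 'rV[R]_2).
Hypothesis convex : convex_position p.
Variable q : 'I_n.+1 -> 'I_n.+1.
Hypothesis q_bij : bijective q.
Hypothesis q_turn : forall i j k : 'I_n.+1,
  (i < j)%N -> (j < k)%N -> 0 < orient p (q i) (q j) (q k).

Definition vertex (x : nat) : 'I_n.+1 := q (inord x).

Definition edge_of (e : nat * nat) : {set 'I_n.+1} := [set vertex e.1; vertex e.2].

Definition enc t : {set {set 'I_n.+1}} := [set e in map edge_of (edges true 0 t)].

Definition rank_of (v : 'I_n.+1) : nat := odflt ord0 [pick i | q i == v].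

Lemma rank_vertex x : (x <= n)%N -> rank_of (vertex x) = x.
Proof.
move=> xn; rewrite /rank_of /vertex; case: pickP => [i|/(_ (inord x))].
  by rewrite (bij_eq q_bij) => /eqP -> /=; rewrite inordK.
by rewrite eqxx.
Qed.

Lemma rankK v : vertex (rank_of v) = v.
Proof.
have [q' q'K qK] := q_bij.
rewrite /rank_of; case: pickP => [i /eqP <-|/(_ (q' v))]; last by rewrite qK eqxx.
by rewrite /vertex /= inord_val.
Qed.

Lemma rank_le v : (rank_of v <= n)%N.
Proof. by rewrite -ltnS ltn_ord. Qed.

Lemma vertex_inj x y : (x <= n)%N -> (y <= n)%N -> vertex x = vertex y -> x = y.
Proof. by move=> xn yn /(congr1 rank_of); rewrite !rank_vertex. Qed.

Lemma edge_of_inj x y x' y' : (x < y <= n)%N -> (x' < y' <= n)%N ->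
  edge_of (x, y) = edge_of (x', y') -> (x, y) = (x', y').
Proof.
move=> xy xy' E.
have hx : x = x' \/ x = y'.
  have : vertex x \in edge_of (x', y') by rewrite -E !inE eqxx.
  by rewrite !inE /= => /orP[] /eqP/vertex_inj h; [left|right]; apply: h; lia.
have hy : y = x' \/ y = y'.
  have : vertex y \in edge_of (x', y') by rewrite -E !inE eqxx orbT.
  by rewrite !inE /= => /orP[] /eqP/vertex_inj h; [left|right]; apply: h; lia.
by congr pair; lia.
Qed.

Lemma card_edge_of x y : (x < y <= n)%N -> #|edge_of (x, y)| = 2%N.
Proof.
move=> xy; rewrite /edge_of cards2; case: eqP => // /vertex_inj /= h.
suff : x = y by lia.
by apply: h; lia.
Qed.

Section Encode.
Variable t : tree.
Hypothesis tn : nodes t = n.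

Lemma enc_range x y : (x, y) \in edges true 0 t -> (x < y <= n)%N.
Proof. by move=> /edges_range[]; rewrite tn; lia. Qed.

Lemma mem_enc x y : (x < y <= n)%N ->
  (edge_of (x, y) \in enc t) = ((x, y) \in edges true 0 t).
Proof.
move=> xy; rewrite inE; apply/mapP/idP => [[[x' y'] h E]|h]; last by exists (x, y).
by rewrite (edge_of_inj xy (enc_range h) E).
Qed.

Lemma uniq_enc : uniq (map edge_of (edges true 0 t)).
Proof.
rewrite map_inj_in_uniq ?uniq_edges // => -[x y] [x' y'] /enc_range h /enc_range h'.
exact: edge_of_inj.
Qed.

Lemma card_enc : #|enc t| = n.
Proof. by rewrite cardsE (card_uniqP uniq_enc) size_map size_edges. Qed.

Lemma adj_enc u v : adj (enc t) u v ->
  linked (edges true 0 t) (rank_of u) (rank_of v).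
Proof.
rewrite /adj inE => /mapP[[x y] xyE uv].
have xy := enc_range xyE.
have ru : rank_of u = x \/ rank_of u = y.
  have : u \in edge_of (x, y) by rewrite -uv !inE eqxx.
  by rewrite !inE /= => /orP[] /eqP->; [left|right]; rewrite rank_vertex //; lia.
have rv : rank_of v = x \/ rank_of v = y.
  have : v \in edge_of (x, y) by rewrite -uv !inE eqxx orbT.
  by rewrite !inE /= => /orP[] /eqP->; [left|right]; rewrite rank_vertex //; lia.
have card2 := card_edge_of xy.
have uv' : rank_of u != rank_of v.
  apply: contraTneq isT => e.
  by move: card2; rewrite -uv -(rankK u) -(rankK v) e cards2 eqxx.
by case: ru rv uv' => [->|->] [->|->]; rewrite ?eqxx // => _; [left|right].
Qed.

Lemma linked_adj x y : linked (edges true 0 t) x y ->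
  adj (enc t) (vertex x) (vertex y).
Proof.
by rewrite /adj => -[] h; [|rewrite finset.setUC];
  rewrite inE; apply/mapP; [exists (x, y)|exists (y, x)].
Qed.

Lemma reach_connect (T : finType) (r : rel T) x y : reach r x y -> connect r x y.
Proof.
elim=> [|u v _ IH uv]; first exact: connect0.
exact: connect_trans IH (connect1 uv).
Qed.

(** A cycle would reach the second end of its first edge from the first without
    using that edge, against the colouring of [edges_cut]. *)
Lemma spanning_enc : spanning_tree (enc t).
Proof.
split.
- by move=> e; rewrite inE => /mapP[[x y] /enc_range xy ->]; apply: card_edge_of.
- move=> u v; rewrite -(rankK u) -(rankK v); apply: reach_connect.
  apply: (@reach_image _ _ (linked (edges true 0 t)) _ vertex).
    by move=> x y /linked_adj; right.
  by apply: edges_connected; rewrite tn add0n /= rank_le.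
case=> [|a [|b [|c s]]] // _; rewrite /ucycle /=.
case/andP=> /andP[ab]; rewrite -/(path _ b (rcons (c :: s) a)).
set s' := c :: s => bs /and3P[anotin bnotin _].
have [z zE zab] : exists2 z, z \in edges true 0 t & [set a; b] = edge_of z.
  by move: ab; rewrite /adj inE => /mapP[z ? ?]; exists z.
have [chi chiP] := edges_cut zE.
pose chi' v := chi (rank_of v).
have cut u v : adj (enc t) u v -> (chi' u != chi' v) -> [set u; v] = [set a; b].
  move=> uv; rewrite /chi'; case: (adj_enc uv) => h; first rewrite (chiP _ _ h).
    by move=> /eqP zz; rewrite zab -zz /edge_of /= !rankK.
  rewrite eq_sym (chiP _ _ h).
  by move=> /eqP zz; rewrite zab -zz /edge_of /= !rankK finset.setUC.
have cab : chi' a != chi' b.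
  have zP x y : (x, y) \in edges true 0 t -> edge_of (x, y) = [set a; b] -> (x, y) == z.
    move=> h; rewrite zab; case: (z) zE => x' y' zE' /edge_of_inj e.
    by apply/eqP/e; apply: enc_range.
  rewrite /chi'; case: (adj_enc ab) => h.
    by rewrite (chiP _ _ h); apply: zP => //; rewrite /edge_of /= !rankK.
  rewrite eq_sym (chiP _ _ h); apply: zP => //.
  by rewrite /edge_of /= !rankK finset.setUC.
have same r u : chi' u = chi' b -> path (adj (enc t)) u r -> a \notin r -> b \notin r ->
    chi' (last u r) = chi' b.
  elim: r u => [|x r IH] u //= ub /andP[ux xr].
  rewrite !in_cons !negb_or => /andP[ax ar] /andP[bx br].
  apply: IH => //; rewrite -ub; apply/eqP/negPn/negP; rewrite eq_sym => /(cut _ _ ux).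
  by move/setP/(_ x); rewrite !inE eqxx orbT eq_sym (negbTE ax) eq_sym (negbTE bx).
have : path (adj (enc t)) b (rcons s' a) by exact: bs.
rewrite rcons_path => /andP[bs' la].
move: anotin; rewrite in_cons negb_or => /andP[_ anotin].
have ls := same s' b erefl bs' anotin bnotin.
have : chi' (last b s') != chi' a by rewrite ls eq_sym.
move/(cut _ _ la)/setP/(_ (last b s')); rewrite !inE eqxx /=.
have lin : last b s' \in s' by rewrite /s' /= mem_last.
case/esym/orP => /eqP e; first by rewrite -e lin in anotin.
by rewrite -e lin in bnotin.
Qed.

Lemma ncst_enc : ncst p (enc t).
Proof.
have sp := spanning_enc; split=> //; have [card2 _ _] := sp.
apply/(non_crossingP convex q_bij q_turn card2) => i j k l ij jk kl.
have E (a b : 'I_n.+1) : [set q a; q b] = edge_of (a : nat, b : nat).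
  by rewrite /edge_of /vertex /= !inord_val.
have kn := ltn_ord k; have ln := ltn_ord l.
rewrite !E mem_enc; last by lia.
rewrite mem_enc; last by lia.
by move=> ik jl; apply: (edges_noncrossing ik jl).
Qed.

End Encode.

Lemma enc_inj t t' : nodes t = n -> nodes t' = n -> enc t = enc t' -> t = t'.
Proof.
move=> tn tn' E; apply: (@edges_inj true 0); first by rewrite tn.
move=> [x y]; have [xy|nxy] := boolP (x < y <= n)%N.
  by rewrite -!mem_enc // E.
by apply/idP/idP => /enc_range h; move: nxy; rewrite h.
Qed.

(** An edge that is no bridge closes a cycle with a shortest path between its
    ends; so [edges_decode] applies. *)
Lemma enc_surj T : ncst p T -> exists2 t, nodes t = n & enc t = T.
Proof.
move=> [[card2 conn acyclic] nc].
have un := (non_crossingP convex q_bij q_turn card2).1 nc.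
pose e : rel nat := fun x y => [&& (x <= n)%N, (y <= n)%N & edge_of (x, y) \in T].
have e_neq x y : e x y -> x != y.
  case/and3P=> _ _ /card2; rewrite /edge_of /=; case: eqVneq => // ->.
  by rewrite cards2 eqxx.
have F : planar_forest e.
  split.
  - by move=> x y; rewrite /e andbCA /edge_of /= finset.setUC.
  - move=> a b c d ab bc cd /and3P[an cn ac] /and3P[bn dn bd].
    by apply: (un (inord a) (inord b) (inord c) (inord d)); rewrite ?inordK.
  move=> x y xy /and3P[xn yn exy] r.
  pose r' : rel 'I_n.+1 := fun u v => adj T u v && ([set u; v] != edge_of (x, y)).
  have : connect r' (vertex x) (vertex y).
    apply: reach_connect; apply: reach_image r => u v [/and3P[un' vn uv] n1 n2]; right.
    apply/andP; split=> //; apply/eqP => E.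
    have uv' : u != v by apply: e_neq; rewrite /e un' vn.
    have [uv2|vu2] : (u < v)%N \/ (v < u)%N by lia.
      have [] : (u, v) = (x, y) by apply: edge_of_inj => //; lia.
      by move=> ? ?; apply: n1.
    have [] : (v, u) = (x, y).
      by apply: edge_of_inj; [lia|lia|rewrite -E /edge_of finset.setUC].
    by move=> ? ?; apply: n2.
  case/connectP => s ps ly; move: ly; case/shortenP: ps => s' ps us _ ly.
  apply: (acyclic (vertex x :: s')).
    case: s' ps ly {us} => [|z [|? ?]] //=.
      by move=> _ /vertex_inj yx; have := yx yn xn; lia.
    by rewrite andbT => /andP[_ nxy] yz; move: nxy; rewrite -yz eqxx.
  rewrite /ucycle us andbT /= rcons_path -ly; apply/andP; split.
    by apply: sub_path ps => u v /andP[].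
  by rewrite /adj finset.setUC.
have [|t tn tP] := @edges_decode e 0 n F.
  move=> x xn; rewrite add0n.
  have : reach (adj T) (vertex 0) (vertex x).
    have /connectP[s ps ->] := conn (vertex 0) (vertex x).
    elim/last_ind: s ps => [|s z IH]; first by move=> _; exact: reach_refl.
    rewrite rcons_path last_rcons => /andP[ps sz].
    exact: reach_step (IH ps) sz.
  have r0 := rank_vertex (leq0n n); have rx : rank_of (vertex x) = x by apply: rank_vertex.
  move=> r; rewrite -[X in reach _ X _]r0 -[X in reach _ _ X]rx.
  apply: (@reach_image _ _ (adj T) _ rank_of) r => u v uv; right.
  by split; rewrite ?rank_le // /e !rank_le /edge_of /= !rankK.
exists t => //; apply/setP => f; apply/idP/idP.
  rewrite inE => /mapP[[x y] xyE ->]; have xy := enc_range tn xyE.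
  have : e x y by rewrite tP //; lia.
  by case/and3P.
move=> fT; have [i [j [ij fE]]] := edge_ends q_bij (card2 _ fT).
have E : f = edge_of (i : nat, j : nat) by rewrite fE /edge_of /vertex /= !inord_val.
have jn := ltn_ord j.
rewrite E mem_enc //; last by rewrite ij -ltnS.
by rewrite -tP // /e -E fT; lia.
Qed.

End TreesOfPoints.

(** * Mixing time of a symmetric kernel that contracts the variance *)
Section ReversibleMixing.
Variables (R : realType) (Omega : finType) (P : Omega -> Omega -> R).
Hypothesis P_stoch : stochastic P.
Hypothesis P_sym : forall x y, P x y = P y x.
Implicit Type g : Omega -> R.

Definition step g x : R := \sum_y P x y * g y.

Lemma sqr_sum_le (I : finType) (A : {pred I}) (f : I -> R) :
  (\sum_(i in A) f i) ^+ 2 <= #|A|%:R * \sum_(i in A) f i ^+ 2.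
Proof.
have : 0 <= \sum_(i in A) \sum_(j in A) (f i - f j) ^+ 2.
  by apply: sumr_ge0 => i _; apply: sumr_ge0 => j _; apply: sqr_ge0.
set S := \sum_(i in A) f i; set Q := \sum_(i in A) f i ^+ 2.
have -> : \sum_(i in A) \sum_(j in A) (f i - f j) ^+ 2 =
    2 * (#|A|%:R * Q) - 2 * S ^+ 2.
  transitivity (\sum_(i in A) (#|A|%:R * f i ^+ 2 + Q - 2 * f i * S)).
    apply: eq_bigr => i _.
    have e j : (f i - f j) ^+ 2 = f i ^+ 2 + f j ^+ 2 - 2 * f i * f j by ring.
    by rewrite (eq_bigr _ (fun j _ => e j)) sumrB big_split /= sumr_const -mulr_sumr -(mulr_natl (f i ^+ 2)).
  rewrite sumrB big_split /= sumr_const -mulr_suml -!mulr_sumr -/S -/Q -(mulr_natl Q).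
  by ring.
by move=> h; rewrite -subr_ge0; lra.
Qed.

Lemma sum_step g : \sum_x step g x = \sum_x g x.
Proof.
rewrite /step exchange_big /=; apply: eq_bigr => y _.
rewrite -mulr_suml (eq_bigr (P y)) => [|x _]; last exact: P_sym.
by rewrite P_stoch.2 mul1r.
Qed.

Lemma dirichletE g :
  \sum_x g x * step g x =
  \sum_x g x ^+ 2 - 2^-1 * \sum_x \sum_y P x y * (g x - g y) ^+ 2.
Proof.
have -> : \sum_x \sum_y P x y * (g x - g y) ^+ 2 =
    2 * \sum_x g x ^+ 2 - 2 * \sum_x g x * step g x.
  transitivity (\sum_x (g x ^+ 2 + step (fun y => g y ^+ 2) x - 2 * (g x * step g x))).
    apply: eq_bigr => x _; rewrite /step.
    have -> : g x ^+ 2 = \sum_y P x y * g x ^+ 2 by rewrite -mulr_suml P_stoch.2 mul1r.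
    rewrite !mulr_sumr -big_split -sumrB /=.
    by apply: eq_bigr => y _; ring.
  rewrite sumrB big_split /= sum_step -!mulr_sumr; ring.
by field.
Qed.

Lemma kernel_pow_rev t x y : kernel_pow P t.+1 x y = \sum_z kernel_pow P t x z * P z y.
Proof.
elim: t x y => [|t IH] x y.
  rewrite /= (bigD1 y) //= eqxx mulr1 big1 ?addr0; last first.
    by move=> z /negbTE ->; rewrite mulr0.
  rewrite [RHS](bigD1 x) //= eqxx mul1r big1 ?addr0 // => z.
  by rewrite eq_sym => /negbTE ->; rewrite mul0r.
rewrite -[kernel_pow P t.+2 x y]/(\sum_z P x z * kernel_pow P t.+1 z y).
under eq_bigr => z _ do rewrite IH mulr_sumr.
rewrite exchange_big /=; apply: eq_bigr => w _.
by rewrite mulr_suml; apply: eq_bigr => z _; rewrite mulrA.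
Qed.

Lemma kernel_pow_sym t x y : kernel_pow P t x y = kernel_pow P t y x.
Proof.
elim: t x y => [|t IH] x y; first by rewrite /= eq_sym.
by rewrite kernel_pow_rev /=; apply: eq_bigr => z _; rewrite mulrC P_sym IH.
Qed.

Variables (K : nat) (s : nat).
Hypothesis K_gt0 : (0 < K)%N.
Hypothesis contraction : forall g, \sum_x g x = 0 ->
  \sum_x step g x ^+ 2 <= (1 - K%:R^-1) * \sum_x g x ^+ 2.
Hypothesis card_le : (#|Omega| <= 2 ^ s)%N.

Definition deviation t x y : R := kernel_pow P t y x - #|Omega|%:R^-1.

Lemma deviation_step t x y : deviation t.+1 x y = step (deviation t x) y.
Proof.
rewrite /deviation /step /=; under [RHS]eq_bigr => z _ do rewrite mulrBr.
by rewrite sumrB -mulr_suml P_stoch.2 mul1r.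
Qed.

Lemma sum_deviation t x : \sum_y deviation t x y = 0.
Proof.
elim: t => [|t IH].
  rewrite sumrB sumr_const (bigD1 x) //= eqxx big1; last by move=> y /negbTE ->.
  rewrite addr0 -[X in _ - X]mulr_natl divff ?subrr // pnatr_eq0 -lt0n.
  by apply/card_gt0P; exists x.
by rewrite (eq_bigr _ (fun y _ => deviation_step t x y)) sum_step.
Qed.

Lemma sqr_deviation t x :
  \sum_y deviation t x y ^+ 2 <= (1 - K%:R^-1) ^+ t.
Proof.
have N0 : 0 < #|Omega|%:R :> R by rewrite ltr0n; apply/card_gt0P; exists x.
have K0 : 0 <= 1 - K%:R^-1 :> R.
  by rewrite subr_ge0 invf_le1 ?ler1n // ltr0n.
elim: t => [|t IH]; last first.
  under eq_bigr => y _ do rewrite deviation_step.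
  apply: le_trans (contraction (sum_deviation t x)) _.
  by rewrite exprS ler_wpM2l.
rewrite expr0.
have -> : \sum_y deviation 0 x y ^+ 2 = \sum_y deviation 0 x y * (y == x)%:R.
  transitivity (\sum_y (deviation 0 x y * (y == x)%:R - #|Omega|%:R^-1 * deviation 0 x y)).
    by apply: eq_bigr => y _; rewrite /deviation /=; ring.
  by rewrite sumrB -mulr_sumr sum_deviation mulr0 subr0.
rewrite (bigD1 x) //= eqxx big1 ?addr0; last by move=> y /negbTE ->; rewrite mulr0.
by rewrite /deviation /= eqxx mulr1 lerBlDr lerDl invr_ge0 ltW.
Qed.

(** (1 - x)^K (1 + x)^K <= 1 and, by Bernoulli, (1 + x)^K >= 2 for x = 1 / K. *)
Lemma half_life : (1 - K%:R^-1) ^+ K <= 2^-1 :> R.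
Proof.
set x : R := K%:R^-1.
have x0 : 0 <= x by rewrite invr_ge0.
have x1 : 0 <= 1 - x by rewrite subr_ge0 invf_le1 ?ler1n // ltr0n.
have bern k : 1 + k%:R * x <= (1 + x) ^+ k.
  elim: k => [|k IH]; first by rewrite mul0r addr0 expr0.
  rewrite exprS; apply: le_trans (ler_wpM2l _ IH); last by rewrite addr_ge0.
  have : 0 <= k%:R * x ^+ 2 by rewrite mulr_ge0 ?sqr_ge0.
  by rewrite -natr1; nra.
have b2 : 2 <= (1 + x) ^+ K.
  by apply: le_trans (bern K); rewrite mulfV ?pnatr_eq0 -?lt0n.
have m1 : (1 - x) ^+ K * (1 + x) ^+ K <= 1.
  by rewrite -exprMn exprn_ile1 //; [apply: mulr_ge0; lra | nra].
have y0 : 0 <= (1 - x) ^+ K by rewrite exprn_ge0.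
have : (1 - x) ^+ K * 2 <= 1 by apply: le_trans m1; rewrite ler_wpM2l.
by lra.
Qed.

(** After s + 2 half-lives the squared norm of the deviation is at most
    2^-(s + 2); Cauchy-Schwarz over at most 2^s states bounds the square of
    its l1-norm by 1/4. *)
Lemma t_mix_le : (t_mix P (@uniform_dist R Omega) <= (K * (s + 2))%:R%:E)%E.
Proof.
apply: ereal_inf_lbound; exists (K * (s + 2))%N => //=.
rewrite /mix_dist; apply/bigmax_leP; split=> [|x _]; first by rewrite invr_ge0.
set t := (K * (s + 2))%N.
have -> : dTV (kernel_pow P t x) (@uniform_dist R Omega) =
    2^-1 * \sum_y `|deviation t x y|.
  by rewrite /dTV; congr (_ * _); apply: eq_bigr => y _; rewrite /deviation kernel_pow_sym.
suff : \sum_y `|deviation t x y| <= 2^-1 by lra.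
have half0 : 0 <= 2^-1 :> R by rewrite invr_ge0.
rewrite -(@ler_pXn2r _ 2) ?nnegrE ?sumr_ge0 //.
apply: le_trans (sqr_sum_le _ _) _.
under eq_bigr => y _ do rewrite real_normK ?num_real //.
have decay : \sum_y deviation t x y ^+ 2 <= 2^-1 ^+ (s + 2).
  apply: le_trans (sqr_deviation t x) _; rewrite /t exprM.
  have K1 : 0 <= 1 - K%:R^-1 :> R by rewrite subr_ge0 invf_le1 ?ler1n // ltr0n.
  by apply: lerXn2r; rewrite ?nnegrE ?exprn_ge0 //; exact: half_life.
apply: le_trans (ler_wpM2l _ decay) _ => //.
have cN : #|Omega|%:R <= 2 ^+ s :> R by rewrite -natrX ler_nat.
apply: le_trans (ler_wpM2r _ cN) _; first by rewrite exprn_ge0.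
by rewrite exprD mulrA -exprMn divff ?expr1n ?mul1r // pnatr_eq0.
Qed.

End ReversibleMixing.

(** * The flip chain *)
Section FlipChain.
Variables (R : realType) (n : nat) (p : 'I_n.+1 -> 'rV[R]_2).
Hypothesis convex : convex_position p.
Hypothesis n_gt0 : (0 < n)%N.
Local Notation Omega := (NCST p).
Local Notation P := (@flip_chain R n p).
Implicit Types (g : Omega -> R) (S T : Omega).

(** From here on the points enter only through this coding, and the cyclic order
    behind it can be forgotten. *)
Lemma tree_coding : exists (code : tree -> {set {set 'I_n.+1}}) (dec : Omega -> tree),
  [/\ forall S, nodes (dec S) = n /\ code (dec S) = val S,
      perm_eq (map dec (enum Omega)) (trees n),
      forall t, nodes t = n -> #|code t| = n &
      forall t t', nodes t = n -> rotation t t' -> (n <= #|code t :&: code t'|.+1)%N].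
Proof.
have [q q_bij q_turn] := cyclic_order convex.
have /choice[dec decP] : forall S, exists t, nodes t = n /\ enc q t = val S.
  move=> S; have /asboolP/(enc_surj convex q_bij q_turn)[t tn tS] := valP S.
  by exists t.
exists (enc q), dec; split=> //.
- apply: uniq_perm; rewrite ?uniq_trees //.
    rewrite map_inj_uniq ?enum_uniq // => S T e; apply/val_inj.
    by rewrite -(decP S).2 -(decP T).2 e.
  move=> t; rewrite mem_trees; apply/mapP/eqP => [[S _ ->]|tn]; first exact: (decP S).1.
  have tP : `[< ncst p (enc q t) >] by apply/asboolP/ncst_enc.
  exists (Sub (enc q t) tP); rewrite ?mem_enum //.
  by apply: (enc_inj q_bij) => //; have [? e] := decP (Sub (enc q t) tP); rewrite ?e.
- by move=> t tn; apply: card_enc.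
move=> t t' tn r; have tn' : nodes t' = n by rewrite -(nodes_rotation r).
have [x [y [s [px py]]]] := edges_rotation true 0 r.
have us : uniq (map (edge_of q) s).
  have := uniq_enc q_bij tn; rewrite (perm_uniq (perm_map _ px)) /=.
  by case/andP.
have sn : (size (map (edge_of q) s)).+1 = n.
  by rewrite size_map -[RHS]tn -(size_edges true 0 t) (perm_size px).
rewrite -[leqLHS]sn ltnS -(card_uniqP us); apply: subset_leq_card; apply/fintype.subsetP => e es.
by rewrite !inE (perm_mem (perm_map _ px)) (perm_mem (perm_map _ py)) /= !in_cons es !orbT.
Qed.

Lemma card_ncst S : #|val S| = n.
Proof.
have [code [dec [decP _ card_code _]]] := tree_coding.
by rewrite -(decP S).2 card_code // (decP S).1.
Qed.

Lemma card_NCST_le : (#|Omega| <= 2 ^ (3 * n))%N.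
Proof.
have [code [dec [_ pe _ _]]] := tree_coding.
by rewrite cardE -(size_map dec) (perm_size pe) size_trees_le.
Qed.

Lemma card_addable_le F : (#|addable p F| <= n.+1 ^ 2)%N.
Proof.
have sub : addable p F \subset [set [set x.1; x.2] | x : 'I_n.+1 * 'I_n.+1].
  apply/fintype.subsetP => f; rewrite inE => /andP[_ /asboolP[[card2 _ _] _]].
  have /eqP/cards2P[a [b [_ ->]]] := card2 f (setU11 _ _).
  by apply/imsetP; exists (a, b).
apply: leq_trans (subset_leq_card sub) _; apply: leq_trans (leq_imset_card _ _) _.
by rewrite card_prod !card_ord mulnn.
Qed.

(** At most (n + 1)^2 edges exist, so delta(S, T) <= (n + 1)^2. *)
Lemma flip_chain_ge S T : S != T -> (n <= #|val S :&: val T|.+1)%N ->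
  (n%:R * n.+1%:R ^+ 2)^-1 <= P S T.
Proof.
move=> ST cap.
have cap_lt : (#|val S :&: val T| < n)%N.
  rewrite -[ltnRHS](card_ncst S); apply: proper_card; rewrite finset.properEneq finset.subsetIl andbT.
  apply: contra_neq ST => e; apply: val_inj; apply/eqP; rewrite eqEcard !card_ncst leqnn andbT.
  by rewrite -{1}e finset.subsetIr.
have cap_eq : #|val S :&: val T|.+1 = n by apply/eqP; rewrite eqn_leq cap_lt.
have -> : P S T = (n%:R * #|addable p (val S :&: val T)|%:R)^-1.
  by rewrite flip_chain_neq // !card_ncst cap_eq eqxx.
have add0 : (0 < #|addable p (val S :&: val T)|)%N.
  have [e eD] : exists e, e \in val S :\: val T.
    apply/finset.set0Pn; rewrite -card_gt0 cardsD card_ncst subn_gt0 //.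
  move: (eD); rewrite inE => /andP[eT eS].
  apply/card_gt0P; exists e.
  have <- : val S :\ e = val S :&: val T; last exact: mem_addable.
  apply/esym/eqP; rewrite eqEcard; apply/andP; split.
    apply/fintype.subsetP => x; rewrite !inE => /andP[xS xT]; rewrite xS andbT.
    by apply: contraNneq eT => <-.
  by rewrite -ltnS cap_eq -[leqRHS](card_ncst S) (cardsD1 e (val S)) eS.
rewrite lef_pV2 ?posrE ?mulr_gt0 ?exprn_gt0 ?ltr0n //.
by rewrite ler_wpM2l // -natrX ler_nat card_addable_le.
Qed.

Definition energy g S : R := \sum_T P S T * (g S - g T) ^+ 2.

Lemma energy_ge0 g S : 0 <= energy g S.
Proof. by apply: sumr_ge0 => T _; rewrite mulr_ge0 ?sqr_ge0 ?flip_chain_ge0. Qed.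

Lemma poincare g : \sum_S g S = 0 ->
  \sum_S g S ^+ 2 <=
  (54 * n ^ 3 * (3 * n + 1) * (n * n.+1 ^ 2))%:R * \sum_S energy g S.
Proof.
move=> g0.
have [code [dec [decP pe card_code rotP]]] := tree_coding.
pose lift (h : Omega -> R) t := if insub (code t) is Some U then h U else 0.
have liftE h S : lift h (dec S) = h S by rewrite /lift (decP S).2 valK.
have sumE h : \sum_(t <- trees n) h t = \sum_S h (dec S) :> R.
  by rewrite -(perm_big _ pe) /= big_map big_enum.
pose D : R := n%:R * n.+1%:R ^+ 2.
have D0 : 0 < D by rewrite mulr_gt0 ?exprn_gt0 ?ltr0n.
pose B := lift (fun S => D * energy g S).
have B0 t : 0 <= B t.
  by rewrite /B /lift; case: insub => // S; rewrite mulr_ge0 ?energy_ge0 // ltW.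
have flipB t t' : nodes t = n -> rotation t t' -> (lift g t - lift g t') ^+ 2 <= B t.
  move=> tn r.
  have code_dec u : nodes u = n -> exists S, dec S = u.
    by move=> /eqP; rewrite -mem_trees -(perm_mem pe) => /mapP[S _ ->]; exists S.
  have [S decS] := code_dec t tn.
  have [T decT] : exists T, dec T = t' by apply: code_dec; rewrite -(nodes_rotation r).
  rewrite -decS -decT /B !liftE.
  have [->|ST] := eqVneq S T.
    by rewrite subrr expr0n mulr_ge0 ?energy_ge0 // ltW.
  have cap := rotP t t' tn r; rewrite -decS -decT !(decP _).2 in cap.
  rewrite -ler_pdivrMl // /energy (bigD1 T) //=.
  apply: le_trans (ler_wpM2r (sqr_ge0 _) (flip_chain_ge ST cap)) _.
  rewrite lerDl; apply: sumr_ge0 => U _.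
  by rewrite mulr_ge0 ?sqr_ge0 ?flip_chain_ge0.
have := trees_poincare B0 flipB.
rewrite !sumE; under eq_bigr => S _ do rewrite liftE.
under [X in X ^+ 2]eq_bigr => S _ do rewrite liftE.
rewrite g0 expr0n mul0r subr0 => /le_trans; apply.
under [X in _ * X]eq_bigr => S _ do rewrite /B liftE.
by rewrite -mulr_sumr mulrA /D -natrX -!natrM.
Qed.

Definition extend g (T : {set {set 'I_n.+1}}) : R :=
  if insub T is Some U then g U else 0.

Definition average g F : R :=
  #|addable p F|%:R^-1 * \sum_(f in addable p F) extend g (f |: F).

Lemma step_average g S :
  step P g S = n%:R^-1 * \sum_(e in val S) average g (val S :\ e).
Proof.
rewrite /step /flip_chain.
under eq_bigr => T _ do rewrite mulr_suml.
rewrite exchange_big /= mulr_sumr; apply: eq_bigr => e eS.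
rewrite card_ncst /average mulr_sumr mulr_sumr.
under eq_bigr => T _ do rewrite mulr_sumr mulr_suml.
rewrite exchange_big /=; apply: eq_bigr => f; rewrite inE => /andP[_ fS].
pose T0 : Omega := Sub (f |: (val S :\ e)) fS.
rewrite (bigD1 T0) //= eqxx mulr1 big1 ?addr0.
  have -> : f |: (val S :\ e) = val T0 by [].
  by rewrite /extend valK mulrA.
by move=> T; rewrite -val_eqE /= => /negbTE ->; rewrite !mulr0 mul0r.
Qed.

(** The tree S with a marked edge e corresponds to the forest S minus e with a
    marked completion. *)
Lemma sum_remove_add (H : {set {set 'I_n.+1}} -> {set {set 'I_n.+1}} -> R) :
  \sum_(S : Omega) \sum_(e in val S) H (val S :\ e) (val S) =
  \sum_F \sum_(f in addable p F) H F (f |: F).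
Proof.
pose Q (F : {set {set 'I_n.+1}}) (f : {set 'I_n.+1}) (S : Omega) := (f \notin F) && (val S == f |: F).
transitivity (\sum_(S : Omega) \sum_f \sum_F if Q F f S then H F (val S) else 0).
  apply: eq_bigr => S _; rewrite big_mkcond /=; apply: eq_bigr => f _.
  rewrite -big_mkcond /=; have [fS|fS] := boolP (f \in val S).
    rewrite (big_pred1 (val S :\ f)) // => F; rewrite /Q /=.
    apply/andP/eqP => [[fF /eqP ->]|->]; first by rewrite finset.setU1K.
    by rewrite finset.setD11 finset.setD1K.
  rewrite big_pred0 // => F; apply/negP => /andP[_ /eqP e].
  by rewrite e setU11 in fS.
under eq_bigr => S _ do rewrite exchange_big /=.
rewrite exchange_big /=; apply: eq_bigr => F _.
rewrite exchange_big /= [RHS]big_mkcond /=; apply: eq_bigr => f _.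
rewrite inE -big_mkcond /=; have [fF|fF] /= := boolP (f \notin F); last first.
  by rewrite big_pred0 // => S; rewrite /Q (negbTE fF).
case: ifPn => fA.
  rewrite (big_pred1 (Sub (f |: F) fA)) //= => S.
  by rewrite /Q fF /= -val_eqE.
rewrite big_pred0 // => S; rewrite /Q fF /=; apply: contraNF fA => /eqP <-.
exact: (valP S).
Qed.

(** Both sides are compared with the sum over forests F, weighted by the number of
    completions, of the squared averages over the completions of F: the right
    side equals it up to the factor 1/n, and the left side is at most that by
    Cauchy-Schwarz over the n edges. *)
Lemma sqr_step_le g : \sum_S step P g S ^+ 2 <= \sum_S g S * step P g S.
Proof.
have n0 : 0 < n%:R :> R by rewrite ltr0n.
have -> : \sum_S g S * step P g S =
    n%:R^-1 * \sum_F #|addable p F|%:R * average g F ^+ 2.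
  transitivity (n%:R^-1 * \sum_(S : Omega) \sum_(e in val S) extend g (val S) * average g (val S :\ e)).
    rewrite mulr_sumr; apply: eq_bigr => S _.
    by rewrite step_average mulrCA mulr_sumr /extend valK.
  rewrite (sum_remove_add (fun F U => extend g U * average g F)); congr (_ * _).
  apply: eq_bigr => F _; rewrite -mulr_suml expr2 mulrA; congr (_ * _).
  rewrite /average mulrA; have [/eqP|A0] := eqVneq #|addable p F| 0%N.
    by rewrite cards_eq0 => /eqP ->; rewrite big_set0 mulr0.
  by rewrite divff ?mul1r // pnatr_eq0.
have -> : \sum_F #|addable p F|%:R * average g F ^+ 2 =
    \sum_(S : Omega) \sum_(e in val S) average g (val S :\ e) ^+ 2.
  rewrite (sum_remove_add (fun F _ => average g F ^+ 2)).
  by apply: eq_bigr => F _; rewrite sumr_const mulr_natl.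
rewrite mulr_sumr; apply: ler_sum => S _; rewrite step_average exprMn expr2 -mulrA.
apply: ler_wpM2l; first by rewrite invr_ge0.
rewrite ler_pdivrMl //.
by have := sqr_sum_le (mem (val S)) (fun e => average g (val S :\ e)); rewrite card_ncst.
Qed.

End FlipChain.

Theorem theorem1 (R : realType) :
  exists (C : R) (N : nat), forall (n : nat) (p : 'I_n.+1 -> 'rV[R]_2),
    (N <= n)%N -> convex_position p ->
    (flip_t_mix p <= (C * n%:R ^+ 8 * ln n%:R)%:E)%E.
Proof.
have ln2 : 0 < ln 2 :> R by rewrite ln_gt0 // ltr1n.
(* 8640 = 8 * 54 * 4 * 5 is the constant of [K * (3 * n + 2)] after 3 n + 1, n + 1
   and 3 n + 2 are replaced by 4 n, 2 n and 5 n. *)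
have [c cE] : exists c : R, c = 8640%:R by exists 8640%:R.
have c0 : 0 <= c by rewrite cE ler0n.
exists (c / ln 2), 2%N => n p n2 convex.
have n0 : (0 < n)%N by apply: leq_trans n2.
pose K := (2 * (54 * n ^ 3 * (3 * n + 1) * (n * n.+1 ^ 2)))%N.
have K0 : (0 < K)%N by rewrite /K !muln_gt0 ?expn_gt0 ?n0 ?addn1.
have stoch := @flip_chain_stochastic R n p n0.
have sym := @flip_chain_sym R n p.
have contraction (g : NCST p -> R) : \sum_x g x = 0 ->
    \sum_x step (@flip_chain R n p) g x ^+ 2 <= (1 - K%:R^-1) * \sum_x g x ^+ 2.
  move=> g0; apply: le_trans (sqr_step_le convex n0 g) _.
  rewrite (dirichletE stoch sym) mulrBl mul1r lerD2l lerN2.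
  rewrite -[X in _ <= _ * X]/(\sum_x energy g x).
  rewrite ler_pdivrMl ?ltr0n //; apply: le_trans (poincare convex n0 g0) _.
  rewrite /K (natrM _ 2); set a : R := (_ * _)%:R; set E := \sum_S _.
  by have -> : 2%:R * a * (2^-1 * E) = a * E by field.
apply: le_trans (t_mix_le stoch sym K0 contraction (card_NCST_le convex)) _.
rewrite lee_fin.
have bound : (K * (3 * n + 2) <= 8640 * n ^ 8)%N.
  have h1 : (3 * n + 1 <= 4 * n)%N by lia.
  have h2 : (n.+1 ^ 2 <= (2 * n) ^ 2)%N by rewrite leq_exp2r //; lia.
  have h3 : (3 * n + 2 <= 5 * n)%N by lia.
  rewrite /K; apply: (@leq_trans (2 * (54 * n ^ 3 * (4 * n) * (n * (2 * n) ^ 2)) * (5 * n))%N).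
    by rewrite leq_mul // leq_mul2l /= leq_mul // ?leq_mul2l ?h1 ?h2 ?orbT.
  have regroup k d e : (2 * (k * n ^ 3 * (d * n) * (n * (2 * n) ^ 2)) * (e * n) =
      8 * k * d * e * n ^ 8)%N by ring.
  by rewrite regroup.
have lnn : ln 2 <= ln n%:R :> R by rewrite ler_ln ?posrE ?ltr0n // ler_nat.
apply: (@le_trans _ _ ((8640 * n ^ 8)%N%:R)); first by rewrite ler_nat.
rewrite natrM natrX -cE.
have -> : c * n%:R ^+ 8 = c / ln 2 * n%:R ^+ 8 * ln 2.
  by rewrite mulrAC divfK // gt_eqF.
by apply: ler_wpM2l => //; rewrite mulr_ge0 ?exprn_ge0 // divr_ge0 // ltW.
Qed.
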